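(* Brownian motion on the free orthogonal quantum groups $O_N^+$ exhibits a cutoff phenomenon at time $t_N=N\ln(N)$: writing $(\psi_t^{(N)})_{t\geq0}$ for the Brownian motion on $O_N^+$ and $h_N$ for the Haar state, for every $\epsilon>0$, $$\lim_{N\to+\infty}\big\|\psi^{(N)}_{(1-\epsilon)t_N}-h_N\big\|=1\quad\text{and}\quad\lim_{N\to+\infty}\big\|\psi^{(N)}_{(1+\epsilon)t_N}-h_N\big\|=0.$$
   Context: Quantum group: $\mathcal{O}(O_N^+)$ is the universal unital $*$-algebra generated by $N^2$ self-adjoint elements $u_{ij}$ with $\sum_k u_{ik}u_{jk}=\delta_{ij}=\sum_k u_{ki}u_{kj}$. Its comultiplication is the $*$-homomorphism $\Delta$ with $\Delta(u_{ij})=\sum_k u_{ik}\otimes u_{kj}$. A state is a linear map $\psi:\mathcal{O}(O_N^+)\to\mathbf{C}$ with $\psi(1)=1$ and $\psi(x^*x)\geq 0$. The Haar state $h_N$ is the unique state with $(\mathrm{id}\otimes h_N)\Delta(x)=h_N(x)1=(h_N\otimes\mathrm{id})\Delta(x)$. Characters: the irreducible representations $u^n$ are indexed by $n\in\mathbf{N}=\{0,1,2,\dots\}$; their characters satisfy $\chi_0=1$, $\chi_1=\sum_i u_{ii}$, $\chi_1\chi_n=\chi_{n+1}+\chi_{n-1}$ for $n\geq1$. Let $P_0=1$, $P_1=X$, $XP_n=P_{n+1}+P_{n-1}$ ($n\ge 1$). The dimension of $u^n$ is $d_n=P_n(N)$. Let $\mathbb{E}$ be the conditional expectation of $\mathcal{O}(O_N^+)$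 onto the algebra spanned by the characters, $\mathbb{E}(u^n_{ij})=\delta_{ij}\chi_n/d_n$. A linear form is central if it is of the form $\widetilde\psi\circ\mathbb{E}$, so it is determined by its values on the $\chi_n$. Brownian motion on $O_N^+$: the convolution semigroup of central states $(\psi^{(N)}_t)_{t\ge0}$ with $\psi_t^{(N)}(\chi_n)=P_n(N)e^{-t\lambda_n}$, $\lambda_n=P_n'(N)/P_n(N)$. Norm: states extend uniquely to the universal enveloping C*-algebra $C(O_N^+)$ of $\mathcal{O}(O_N^+)$; $\|\cdot\|=\frac12\|\cdot\|_{FS}$, where $\|\cdot\|_{FS}$ is the norm of the dual Banach space $C(O_N^+)^*$. (For $\epsilon\ge 1$, where $(1-\epsilon)t_N$ is not a positive time, only the second limit is meant.) *)

(* Defs.v *)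
From HB Require Import structures.
From mathcomp Require Import all_boot all_order all_algebra.
From mathcomp Require Import complex.
From mathcomp Require Import all_classical all_reals all_analysis.

Set Implicit Arguments.
Unset Strict Implicit.
Unset Printing Implicit Defensive.

Import Order.TTheory GRing.Theory Num.Theory.
Import numFieldNormedType.Exports.
Import ComplexField.

Local Open Scope quotient_scope.
Local Open Scope classical_set_scope.
Local Open Scope complex_scope.
Local Open Scope ring_scope.

HB.mixin Record hasStar (C : numClosedFieldType) A of GRing.Algebra C A := {
  star : A -> A;
  starK : involutive star;
  starD : {morph star : x y / x + y};
  starZ : forall (c : C) (x : A), star (c *: x) = Num.conj c *: star x;
  starM : forall x y : A, star (x * y) = star y * star x
}.

#[short(type="starAlgType")]
HB.structure Definition StarAlgebra (C : numClosedFieldType) :=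
  {A of GRing.Algebra C A & hasStar C A}.

Section StarTheory.
Variables (C : numClosedFieldType) (A : starAlgType C).

Lemma star0 : star (0 : A) = 0.
Proof. by apply: (addrI (star 0)); rewrite -starD !addr0. Qed.

Lemma star1 : star (1 : A) = 1.
Proof. by rewrite -[LHS]mulr1 -[X in _ * X]starK -starM mulr1 starK. Qed.

Lemma star_sum (I : Type) (r : seq I) (P : pred I) (F : I -> A) :
  star (\sum_(i <- r | P i) F i) = \sum_(i <- r | P i) star (F i).
Proof. exact: (big_morph _ (@starD C A) star0). Qed.

End StarTheory.

Definition star_morphism (C : numClosedFieldType) (A B : starAlgType C)
    (f : A -> B) := forall x, f (star x) = star (f x).

Section ScalarStar.
Variable C : numClosedFieldType.

Lemma scalar_starK : involutive (fun c : C^o => Num.conj c : C^o).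
Proof. exact: conjCK. Qed.
Lemma scalar_starD : {morph (fun c : C^o => Num.conj c : C^o) : x y / x + y}.
Proof. by move=> x y; rewrite rmorphD. Qed.
Lemma scalar_starZ (c : C) (x : C^o) :
  Num.conj (c *: x : C^o) = Num.conj c *: (Num.conj x : C^o).
Proof. exact: rmorphM. Qed.
Lemma scalar_starM (x y : C^o) :
  Num.conj (x * y : C^o) = (Num.conj y : C^o) * (Num.conj x : C^o).
Proof. by rewrite mulrC rmorphM. Qed.

HB.instance Definition _ := @hasStar.Build C C^o
  (fun c => Num.conj c) scalar_starK scalar_starD scalar_starZ scalar_starM.

End ScalarStar.

(* The universal *-algebra O(O_N^+) is the set of *-polynomial expressions in  *)
(* N^2 letters, two expressions being identified when they agree at every      *)
(* N x N matrix of self-adjoint elements of a *-algebra that satisfies the     *)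
(* defining relations.                                                         *)
Definition orthogonal_mx (C : numClosedFieldType) (N : nat) (B : starAlgType C)
    (v : 'M[B]_N) :=
  [/\ forall i j, star (v i j) = v i j,
      forall i j, \sum_k v i k * v j k = (i == j)%:R
    & forall i j, \sum_k v k i * v k j = (i == j)%:R].

Inductive oterm (C : numClosedFieldType) (N : nat) : Type :=
  | OGen of 'I_N & 'I_N
  | OCst of C
  | OAdd of oterm C N & oterm C N
  | OMul of oterm C N & oterm C N
  | OStar of oterm C N.

HB.instance Definition _ C N := gen_eqMixin (oterm C N).
HB.instance Definition _ C N := gen_choiceMixin (oterm C N).

Fixpoint oeval (C : numClosedFieldType) (N : nat) (B : starAlgType C)
    (v : 'M[B]_N) (t : oterm C N) : B :=
  match t with
  | OGen i j => v i j
  | OCst c => c%:A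
  | OAdd t1 t2 => oeval v t1 + oeval v t2
  | OMul t1 t2 => oeval v t1 * oeval v t2
  | OStar t1 => star (oeval v t1)
  end.

Section FreeOrthogonal.
Variables (C : numClosedFieldType) (N : nat).

Definition oterm_eq (t s : oterm C N) : bool :=
  `[< forall (B : starAlgType C) (v : 'M[B]_N),
        orthogonal_mx v -> oeval v t = oeval v s >].

Lemma oterm_eq_refl : reflexive oterm_eq.
Proof. by move=> t; apply/asboolP. Qed.
Lemma oterm_eq_sym : symmetric oterm_eq.
Proof.
by move=> t s; apply/asboolP/asboolP => e B v ov; rewrite (e B v ov).
Qed.
Lemma oterm_eq_trans : transitive oterm_eq.
Proof.
move=> s t r /asboolP ts /asboolP sr; apply/asboolP => B v ov.
by rewrite (ts B v ov) (sr B v ov).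
Qed.

Canonical oterm_equiv :=
  EquivRel oterm_eq oterm_eq_refl oterm_eq_sym oterm_eq_trans.

Definition OON := {eq_quot oterm_equiv}.
HB.instance Definition _ := Choice.on OON.
HB.instance Definition _ := EqQuotient.on OON.

Definition olift (B : starAlgType C) (v : 'M[B]_N) (x : OON) : B :=
  oeval v (repr x).

Lemma olift_pi (B : starAlgType C) (v : 'M[B]_N) (t : oterm C N) :
  orthogonal_mx v -> olift v (\pi_OON t) = oeval v t.
Proof.
move=> ov; rewrite /olift.
have : repr (\pi_OON t) = t %[mod OON] by rewrite reprK.
by move=> /eqmodP/asboolP ->.
Qed.

Lemma OON_ext (x y : OON) :
  (forall (B : starAlgType C) (v : 'M[B]_N), orthogonal_mx v ->
    olift v x = olift v y) -> x = y.
Proof.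
elim/quotW: x => t; elim/quotW: y => s e.
apply/eqmodP/asboolP => B v ov.
by have := e B v ov; rewrite !olift_pi.
Qed.

Definition oadd (x y : OON) : OON := \pi_OON (OAdd (repr x) (repr y)).
Definition omul (x y : OON) : OON := \pi_OON (OMul (repr x) (repr y)).
Definition ocst (c : C) : OON := \pi_OON (OCst N c).
Definition oopp (x : OON) : OON := omul (ocst (-1)) x.
Definition oscale (c : C) (x : OON) : OON := omul (ocst c) x.
Definition ostar (x : OON) : OON := \pi_OON (OStar (repr x)).

Section Lift.
Variables (B : starAlgType C) (v : 'M[B]_N) (ov : orthogonal_mx v).
Lemma olift_add x y : olift v (oadd x y) = olift v x + olift v y.
Proof. by rewrite olift_pi. Qed.
Lemma olift_mul x y : olift v (omul x y) = olift v x * olift v y.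
Proof. by rewrite olift_pi. Qed.
Lemma olift_cst c : olift v (ocst c) = c%:A.
Proof. by rewrite olift_pi. Qed.
Lemma olift_scale c x : olift v (oscale c x) = c *: olift v x.
Proof. by rewrite olift_mul olift_cst -scalerAl mul1r. Qed.
Lemma olift_opp x : olift v (oopp x) = - olift v x.
Proof. by rewrite olift_scale scaleN1r. Qed.
Lemma olift_star x : olift v (ostar x) = star (olift v x).
Proof. by rewrite olift_pi. Qed.
End Lift.

Definition oliftE := (olift_opp, olift_scale, olift_add, olift_mul, olift_cst,
  olift_star).

Lemma OON_addA : associative oadd.
Proof. by move=> x y z; apply: OON_ext => B v ov; rewrite !oliftE// addrA. Qed.
Lemma OON_addC : commutative oadd.
Proof. by move=> x y; apply: OON_ext => B v ov; rewrite !oliftE// addrC. Qed.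
Lemma OON_add0 : left_id (ocst 0) oadd.
Proof.
by move=> x; apply: OON_ext => B v ov; rewrite !oliftE// scale0r add0r.
Qed.
Lemma OON_addN : left_inverse (ocst 0) oopp oadd.
Proof.
by move=> x; apply: OON_ext => B v ov; rewrite !oliftE// scale0r addNr.
Qed.
HB.instance Definition _ :=
  GRing.isZmodule.Build OON OON_addA OON_addC OON_add0 OON_addN.

Lemma OON_mulA : associative omul.
Proof. by move=> x y z; apply: OON_ext => B v ov; rewrite !oliftE// mulrA. Qed.
Lemma OON_mul1 : left_id (ocst 1) omul.
Proof.
by move=> x; apply: OON_ext => B v ov; rewrite !oliftE// scale1r mul1r.
Qed.
Lemma OON_mulr1 : right_id (ocst 1) omul.
Proof.
by move=> x; apply: OON_ext => B v ov; rewrite !oliftE// scale1r mulr1.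
Qed.
Lemma OON_mulDl : left_distributive omul oadd.
Proof. by move=> x y z; apply: OON_ext => B v ov; rewrite !oliftE// mulrDl. Qed.
Lemma OON_mulDr : right_distributive omul oadd.
Proof. by move=> x y z; apply: OON_ext => B v ov; rewrite !oliftE// mulrDr. Qed.

Lemma orthogonal_mx1 : orthogonal_mx (1%:M : 'M[C^o]_N).
Proof.
have E i j : \sum_k (1%:M : 'M[C^o]_N) i k * (1%:M : 'M[C^o]_N) j k
    = (i == j)%:R.
  rewrite (bigD1 i)//= big1 ?addr0; last first.
    by move=> k ki; rewrite mxE eq_sym (negPf ki) mul0r.
  by rewrite !mxE eqxx mul1r eq_sym.
split=> // i j.
- by rewrite /star/= mxE; case: (i == j); rewrite /= ?rmorph1 ?rmorph0.
- rewrite -E; apply: eq_bigr => k _.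
  by rewrite !mxE ![k == _]eq_sym.
Qed.

Lemma OON_1neq0 : ocst 1 != 0 :> OON.
Proof.
apply/eqP => /(congr1 (olift (1%:M : 'M[C^o]_N))).
rewrite !(olift_cst orthogonal_mx1) scale1r scale0r => /eqP.
by rewrite oner_eq0.
Qed.

HB.instance Definition _ := GRing.Zmodule_isNzRing.Build OON
  OON_mulA OON_mul1 OON_mulr1 OON_mulDl OON_mulDr OON_1neq0.

Lemma OON_scaleA c d x : oscale c (oscale d x) = oscale (c * d) x.
Proof. by apply: OON_ext => B v ov; rewrite !oliftE// scalerA. Qed.
Lemma OON_scale1 : left_id 1 oscale.
Proof. by move=> x; apply: OON_ext => B v ov; rewrite !oliftE// scale1r. Qed.
Lemma OON_scaleDr : right_distributive oscale +%R.
Proof.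
by move=> c x y; apply: OON_ext => B v ov; rewrite !oliftE// scalerDr.
Qed.
Lemma OON_scaleDl x : {morph oscale^~ x : c d / c + d}.
Proof.
by move=> c d; apply: OON_ext => B v ov; rewrite !oliftE// scalerDl.
Qed.
HB.instance Definition _ := GRing.Zmodule_isLmodule.Build C OON
  OON_scaleA OON_scale1 OON_scaleDr OON_scaleDl.

Lemma OON_scaleAl (c : C) (x y : OON) : c *: (x * y) = (c *: x) * y.
Proof. by apply: OON_ext => B v ov; rewrite !oliftE// scalerAl. Qed.
HB.instance Definition _ := GRing.Lmodule_isLalgebra.Build C OON OON_scaleAl.

Lemma OON_scaleAr (c : C) (x y : OON) : c *: (x * y) = x * (c *: y).
Proof. by apply: OON_ext => B v ov; rewrite !oliftE// scalerAr. Qed.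
HB.instance Definition _ := GRing.Lalgebra_isAlgebra.Build C OON OON_scaleAr.

Lemma OON_starK : involutive ostar.
Proof. by move=> x; apply: OON_ext => B v ov; rewrite !oliftE// starK. Qed.
Lemma OON_starD : {morph ostar : x y / x + y}.
Proof. by move=> x y; apply: OON_ext => B v ov; rewrite !oliftE// starD. Qed.
Lemma OON_starZ (c : C) (x : OON) : ostar (c *: x) = Num.conj c *: ostar x.
Proof. by apply: OON_ext => B v ov; rewrite !oliftE// starZ. Qed.
Lemma OON_starM (x y : OON) : ostar (x * y) = ostar y * ostar x.
Proof. by apply: OON_ext => B v ov; rewrite !oliftE// starM. Qed.
HB.instance Definition _ := hasStar.Build C OON
  OON_starK OON_starD OON_starZ OON_starM.

Definition ogen : 'M[OON]_N := \matrix_(i, j) \pi_OON (OGen C i j).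

End FreeOrthogonal.

Lemma olift_ogen (C : numClosedFieldType) (N : nat) (x : OON C N) :
  olift (ogen C N) x = x.
Proof.
apply: OON_ext => B v ov; rewrite [in RHS]/olift [olift (ogen C N) x]/olift.
elim: (repr x) => /= [i j|c|t1 IH1 t2 IH2|t1 IH1 t2 IH2|t1 IH1].
- by rewrite mxE olift_pi.
- by rewrite [LHS]olift_scale// [X in c *: X]olift_cst// scale1r.
- by rewrite [LHS]olift_add// IH1 IH2.
- by rewrite [LHS]olift_mul// IH1 IH2.
- by rewrite [LHS]olift_star// IH1.
Qed.

Section Lift.
Variables (C : numClosedFieldType) (N : nat) (B : starAlgType C).
Variables (v : 'M[B]_N) (ov : orthogonal_mx v).

Lemma olift_gen i j : olift v (ogen C N i j) = v i j.
Proof. by rewrite mxE olift_pi. Qed.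

Lemma olift_is_linear : linear (olift v : OON C N -> B).
Proof. by move=> c x y; rewrite olift_add// olift_scale. Qed.

Lemma olift_is_monoid_morphism :
  monoid_morphism (olift v : OON C N -> B).
Proof.
by split=> [|x y]; [rewrite olift_cst// scale1r | rewrite olift_mul].
Qed.

Lemma olift_is_star_morphism : star_morphism (olift v : OON C N -> B).
Proof. by move=> x; rewrite [LHS]olift_star. Qed.

End Lift.

Lemma ogen_orthogonal (C : numClosedFieldType) (N : nat) : orthogonal_mx (ogen C N).
Proof.
have sumE (D : starAlgType C) (w : 'M[D]_N) (F : 'I_N -> OON C N) :
    orthogonal_mx w -> olift w (\sum_k F k) = \sum_k olift w (F k).
  move=> ow; apply: (big_morph (olift w : OON C N -> D)).
    by move=> x y; rewrite [LHS]olift_add.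
  by rewrite [LHS]olift_cst// scale0r.
have natE (D : starAlgType C) (w : 'M[D]_N) (b : bool) :
    orthogonal_mx w -> olift w (b%:R : OON C N) = b%:R.
  by move=> ow; case: b; rewrite [LHS]olift_cst// ?scale1r ?scale0r.
split=> i j; apply: OON_ext => D w ow; have [w1 w2 w3] := ow.
- by rewrite [LHS]olift_star// mxE olift_pi//= w1.
- rewrite sumE// natE// -w2; apply: eq_bigr => k _.
  by rewrite [LHS]olift_mul// !mxE !olift_pi.
- rewrite sumE// natE// -w3; apply: eq_bigr => k _.
  by rewrite [LHS]olift_mul// !mxE !olift_pi.
Qed.

(* The algebraic tensor product is the set of finite formal sums of pairs, two *)
(* formal sums being identified when all bilinear maps agree on them.          *)
Definition bilinear_map (C : numClosedFieldType) (A B V : lmodType C)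
    (f : A -> B -> V) :=
  (forall b, linear (f^~ b)) /\ (forall a, linear (f a)).

Definition fsum (C : numClosedFieldType) (A B : lmodType C) := seq (A * B).
HB.instance Definition _ C A B := Choice.on (@fsum C A B).

Definition fsum_eval (C : numClosedFieldType) (A B V : lmodType C)
    (f : A -> B -> V) (s : fsum A B) : V := \sum_(p <- s) f p.1 p.2.

Section Tensor.
Variables (C : numClosedFieldType) (A B : starAlgType C).

Definition fsum_eq (s t : fsum A B) : bool :=
  `[< forall (V : lmodType C) (f : A -> B -> V), bilinear_map f ->
        fsum_eval f s = fsum_eval f t >].

Lemma fsum_eq_refl : reflexive fsum_eq.
Proof. by move=> t; apply/asboolP. Qed.
Lemma fsum_eq_sym : symmetric fsum_eq.
Proof.
by move=> t s; apply/asboolP/asboolP => e V f bf; rewrite (e V f bf).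
Qed.
Lemma fsum_eq_trans : transitive fsum_eq.
Proof.
move=> s t r /asboolP ts /asboolP sr; apply/asboolP => V f bf.
by rewrite (ts V f bf) (sr V f bf).
Qed.

Canonical fsum_equiv := EquivRel fsum_eq fsum_eq_refl fsum_eq_sym fsum_eq_trans.

Definition tensor := {eq_quot fsum_equiv}.
HB.instance Definition _ := Choice.on tensor.
HB.instance Definition _ := EqQuotient.on tensor.

Definition tlift (V : lmodType C) (f : A -> B -> V) (x : tensor) : V :=
  fsum_eval f (repr x).

Lemma tlift_pi (V : lmodType C) (f : A -> B -> V) (s : fsum A B) :
  bilinear_map f -> tlift f (\pi_tensor s) = fsum_eval f s.
Proof.
move=> bf; rewrite /tlift.
have : repr (\pi_tensor s) = s %[mod tensor] by rewrite reprK.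
by move=> /eqmodP/asboolP ->.
Qed.

Lemma tensor_ext (x y : tensor) :
  (forall (V : lmodType C) (f : A -> B -> V), bilinear_map f ->
    tlift f x = tlift f y) -> x = y.
Proof.
elim/quotW: x => t; elim/quotW: y => s e.
apply/eqmodP/asboolP => V f bf.
by have := e V f bf; rewrite !tlift_pi.
Qed.

Definition tens (a : A) (b : B) : tensor := \pi_tensor [:: (a, b)].
Definition tadd (x y : tensor) : tensor := \pi_tensor (repr x ++ repr y).
Definition tzero : tensor := \pi_tensor [::].
Definition tscale (c : C) (x : tensor) : tensor :=
  \pi_tensor [seq (c *: p.1, p.2) | p <- repr x].
Definition topp (x : tensor) : tensor := tscale (-1) x.
Definition tmul (x y : tensor) : tensor :=
  \pi_tensor [seq (p.1 * q.1, p.2 * q.2) | p <- repr x, q <- repr y].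
Definition tstar (x : tensor) : tensor :=
  \pi_tensor [seq (star p.1, star p.2) | p <- repr x].

Section TLift.
Variables (V : lmodType C) (f : A -> B -> V) (bf : bilinear_map f).

Lemma bilinDl a a' b : f (a + a') b = f a b + f a' b.
Proof. by have := bf.1 b 1 a a'; rewrite !scale1r. Qed.
Lemma bilinDr a b b' : f a (b + b') = f a b + f a b'.
Proof. by have := bf.2 a 1 b b'; rewrite !scale1r. Qed.
Lemma bilin0l b : f 0 b = 0.
Proof. by have := bf.1 b (-1) 0 0; rewrite !scaleN1r !addNr. Qed.
Lemma bilin0r a : f a 0 = 0.
Proof. by have := bf.2 a (-1) 0 0; rewrite !scaleN1r !addNr. Qed.
Lemma bilinZl c a b : f (c *: a) b = c *: f a b.
Proof. by have := bf.1 b c a 0; rewrite bilin0l !addr0. Qed.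
Lemma bilinZr c a b : f a (c *: b) = c *: f a b.
Proof. by have := bf.2 a c b 0; rewrite bilin0r !addr0. Qed.

Lemma tlift_tens a b : tlift f (tens a b) = f a b.
Proof. by rewrite tlift_pi// /fsum_eval big_seq1. Qed.
Lemma tlift_add x y : tlift f (tadd x y) = tlift f x + tlift f y.
Proof. by rewrite tlift_pi// /fsum_eval big_cat. Qed.
Lemma tlift_zero : tlift f tzero = 0.
Proof. by rewrite tlift_pi// /fsum_eval big_nil. Qed.
Lemma tlift_scale c x : tlift f (tscale c x) = c *: tlift f x.
Proof.
rewrite tlift_pi// /fsum_eval big_map scaler_sumr.
by apply: eq_bigr => p _; rewrite bilinZl.
Qed.
Lemma tlift_opp x : tlift f (topp x) = - tlift f x.
Proof. by rewrite tlift_scale scaleN1r. Qed.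

Lemma bilin_mulr x : bilinear_map
  (fun a b => tlift (fun a' b' => f (a * a') (b * b')) x).
Proof.
split=> [b|a] c u w /=; rewrite /tlift /fsum_eval scaler_sumr -big_split/=;
  apply: eq_bigr => p _.
- by rewrite mulrDl bilinDl -scalerAl bilinZl.
- by rewrite mulrDl bilinDr -scalerAl bilinZr.
Qed.
Lemma bilin_mulM (a : A) (b : B) :
  bilinear_map (fun a' b' => f (a * a') (b * b')).
Proof.
split=> [b'|a'] c u w /=.
- by rewrite mulrDr bilinDl -scalerAr bilinZl.
- by rewrite mulrDr bilinDr -scalerAr bilinZr.
Qed.

Lemma tlift_mul x y : tlift f (tmul x y) =
  tlift (fun a b => tlift (fun a' b' => f (a * a') (b * b')) y) x.
Proof.
rewrite tlift_pi// /fsum_eval big_allpairs_dep/=.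
by apply: eq_bigr => p _.
Qed.

End TLift.

Definition tliftE := (tlift_opp, tlift_scale, tlift_add, tlift_zero, tlift_tens).

Lemma tensor_addA : associative tadd.
Proof. by move=> x y z; apply: tensor_ext => V f bf; rewrite !tliftE// addrA. Qed.
Lemma tensor_addC : commutative tadd.
Proof. by move=> x y; apply: tensor_ext => V f bf; rewrite !tliftE// addrC. Qed.
Lemma tensor_add0 : left_id tzero tadd.
Proof. by move=> x; apply: tensor_ext => V f bf; rewrite !tliftE// add0r. Qed.
Lemma tensor_addN : left_inverse tzero topp tadd.
Proof. by move=> x; apply: tensor_ext => V f bf; rewrite !tliftE// addNr. Qed.
HB.instance Definition _ :=
  GRing.isZmodule.Build tensor tensor_addA tensor_addC tensor_add0 tensor_addN.

Lemma tensor_scaleA c d x : tscale c (tscale d x) = tscale (c * d) x.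
Proof. by apply: tensor_ext => V f bf; rewrite !tliftE// scalerA. Qed.
Lemma tensor_scale1 : left_id 1 tscale.
Proof. by move=> x; apply: tensor_ext => V f bf; rewrite !tliftE// scale1r. Qed.
Lemma tensor_scaleDr : right_distributive tscale +%R.
Proof.
by move=> c x y; apply: tensor_ext => V f bf; rewrite !tliftE// scalerDr.
Qed.
Lemma tensor_scaleDl x : {morph tscale^~ x : c d / c + d}.
Proof.
by move=> c d; apply: tensor_ext => V f bf; rewrite !tliftE// scalerDl.
Qed.
HB.instance Definition _ := GRing.Zmodule_isLmodule.Build C tensor
  tensor_scaleA tensor_scale1 tensor_scaleDr tensor_scaleDl.

Lemma tens_bilinear : bilinear_map tens.
Proof.
split=> [b|a] c u w /=; apply: tensor_ext => V f bf;
  rewrite tlift_tens// [RHS]tlift_add// [X in _ = X + _]tlift_scale// !tlift_tens//.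
- by rewrite bilinDl// bilinZl.
- by rewrite bilinDr// bilinZr.
Qed.

Lemma tens_ind (P : tensor -> Prop) : P 0 ->
  (forall a b x, P x -> P (tens a b + x)) -> forall x, P x.
Proof.
move=> P0 PD; elim/quotW => s.
elim: s => [|[a b] s Ps]; first exact: P0.
suff -> : \pi_tensor ((a, b) :: s) = tens a b + \pi_tensor s by exact: PD.
apply: tensor_ext => V f bf.
by rewrite [RHS]tlift_add// !tlift_pi// /fsum_eval big_cons big_seq1.
Qed.

Lemma tmulDl : left_distributive tmul +%R.
Proof.
move=> x y z; apply: tensor_ext => V f bf.
rewrite tlift_mul// [RHS]tlift_add// !tlift_mul//.
rewrite [LHS]tlift_add//; exact: bilin_mulr.
Qed.
Lemma tmulDr : right_distributive tmul +%R.
Proof.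
move=> x y z; apply: tensor_ext => V f bf.
rewrite tlift_mul// [RHS]tlift_add// !tlift_mul//.
rewrite /(tlift _ x) /fsum_eval -big_split/=; apply: eq_bigr => p _.
exact: (tlift_add (bilin_mulM bf p.1 p.2)).
Qed.
Lemma tmul_tens a b a' b' : tmul (tens a b) (tens a' b') = tens (a * a') (b * b').
Proof.
apply: tensor_ext => V f bf.
rewrite tlift_mul// !tlift_tens//; [exact: bilin_mulM|exact: bilin_mulr].
Qed.
Lemma tmulZl c x y : tmul (c *: x) y = c *: tmul x y.
Proof.
apply: tensor_ext => V f bf.
rewrite tlift_mul// [RHS]tlift_scale// tlift_mul//.
rewrite [LHS]tlift_scale//; exact: bilin_mulr.
Qed.
Lemma tmulZr c x y : tmul x (c *: y) = c *: tmul x y.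
Proof.
apply: tensor_ext => V f bf.
rewrite tlift_mul// [RHS]tlift_scale// tlift_mul//.
rewrite /(tlift _ x) /fsum_eval scaler_sumr; apply: eq_bigr => p _.
exact: (tlift_scale (bilin_mulM bf p.1 p.2)).
Qed.
Lemma tmul0l x : tmul 0 x = 0.
Proof. by have := tmulZl 0 0 x; rewrite !scale0r. Qed.
Lemma tmul0r x : tmul x 0 = 0.
Proof. by have := tmulZr 0 x 0; rewrite !scale0r. Qed.
Lemma tensor_mulA : associative tmul.
Proof.
move=> x y z; elim/tens_ind: x => [|a b x IH]; first by rewrite !tmul0l.
rewrite !tmulDl -IH; congr (_ + _); clear.
elim/tens_ind: y => [|a' b' y IH]; first by rewrite !(tmul0l, tmul0r).
rewrite !(tmulDl, tmulDr) IH; congr (_ + _); clear.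
elim/tens_ind: z => [|a'' b'' z IH]; first by rewrite !tmul0r.
by rewrite !tmulDr IH !tmul_tens !mulrA.
Qed.
Lemma tensor_mul1 : left_id (tens 1 1) tmul.
Proof.
elim/tens_ind => [|a b x IH]; first exact: tmul0r.
by rewrite tmulDr IH tmul_tens !mul1r.
Qed.
Lemma tensor_mulr1 : right_id (tens 1 1) tmul.
Proof.
elim/tens_ind => [|a b x IH]; first exact: tmul0l.
by rewrite tmulDl IH tmul_tens !mulr1.
Qed.

HB.instance Definition _ := GRing.Zmodule_isPzRing.Build tensor
  tensor_mulA tensor_mul1 tensor_mulr1 tmulDl tmulDr.

Lemma tensor_scaleAl (c : C) (x y : tensor) : c *: (x * y) = (c *: x) * y.
Proof. by rewrite [RHS]tmulZl. Qed.
Lemma tensor_scaleAr (c : C) (x y : tensor) : c *: (x * y) = x * (c *: y).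
Proof. by rewrite [RHS]tmulZr. Qed.

End Tensor.

Definition conjmod (C : numClosedFieldType) (V : lmodType C) : Type := V.

Section ConjMod.
Variables (C : numClosedFieldType) (V : lmodType C).
HB.instance Definition _ := GRing.Zmodule.on (conjmod V).

Definition conjmod_scale (c : C) (v : conjmod V) : conjmod V :=
  Num.conj c *: (v : V).
Lemma conjmod_scaleA c d v :
  conjmod_scale c (conjmod_scale d v) = conjmod_scale (c * d) v.
Proof. by rewrite /conjmod_scale scalerA rmorphM. Qed.
Lemma conjmod_scale1 : left_id 1 conjmod_scale.
Proof. by move=> v; rewrite /conjmod_scale rmorph1 scale1r. Qed.
Lemma conjmod_scaleDr : right_distributive conjmod_scale +%R.
Proof. by move=> c u v; rewrite /conjmod_scale scalerDr. Qed.
Lemma conjmod_scaleDl v : {morph conjmod_scale^~ v : c d / c + d}.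
Proof. by move=> c d; rewrite /conjmod_scale rmorphD scalerDl. Qed.
HB.instance Definition _ := GRing.Zmodule_isLmodule.Build C (conjmod V)
  conjmod_scaleA conjmod_scale1 conjmod_scaleDr conjmod_scaleDl.
End ConjMod.

Section TensorStar.
Variables (C : numClosedFieldType) (A B : starAlgType C).
Local Notation T := (tensor A B).

Section Bilin.
Variables (V : lmodType C) (f : A -> B -> V) (bf : bilinear_map f).
Definition conj_bilin (a : A) (b : B) : conjmod V := f (star a) (star b).
Lemma conj_bilinP : bilinear_map conj_bilin.
Proof.
split=> [b|a] c u w; rewrite /conj_bilin starD starZ.
- by rewrite bilinDl// bilinZl.
- by rewrite bilinDr// bilinZr.
Qed.
Lemma tlift_star (x : T) : tlift f (tstar x) = tlift conj_bilin x :> V.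
Proof. by rewrite tlift_pi// /tlift /fsum_eval big_map. Qed.
End Bilin.

Lemma tstarD : {morph @tstar C A B : x y / x + y}.
Proof.
move=> x y; apply: tensor_ext => V f bf.
rewrite tlift_star// [RHS]tlift_add// !tlift_star//.
exact: (tlift_add (conj_bilinP bf)).
Qed.
Lemma tstarZ (c : C) (x : T) : tstar (c *: x) = Num.conj c *: tstar x.
Proof.
apply: tensor_ext => V f bf.
rewrite tlift_star// [RHS]tlift_scale// !tlift_star//.
exact: (tlift_scale (conj_bilinP bf)).
Qed.
Lemma tstar_tens a b : tstar (tens a b : T) = tens (star a) (star b).
Proof.
apply: tensor_ext => V f bf.
by rewrite tlift_star// !tlift_tens//; exact: conj_bilinP.
Qed.
Lemma tstar0 : tstar (0 : T) = 0.
Proof. by have := tstarZ 0 0; rewrite rmorph0 !scale0r. Qed.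
Lemma tstarK : involutive (@tstar C A B).
Proof.
elim/tens_ind => [|a b x IH]; first by rewrite !tstar0.
by rewrite !tstarD IH !tstar_tens !starK.
Qed.
Lemma tstarM (x y : T) : tstar (x * y) = tstar y * tstar x.
Proof.
elim/tens_ind: x => [|a b x IH]; first by rewrite mul0r tstar0 mulr0.
rewrite mulrDl !tstarD mulrDr -IH; congr (_ + _); clear.
elim/tens_ind: y => [|a' b' y IH]; first by rewrite mulr0 tstar0 mul0r.
rewrite mulrDr !tstarD mulrDl IH; congr (_ + _).
by rewrite [_ * _]tmul_tens !tstar_tens [RHS]tmul_tens !starM.
Qed.
End TensorStar.

Section OON2.
Variables (C : numClosedFieldType) (N : nat).
Local Notation A := (OON C N).

Lemma OON2_1neq0 : (1 : tensor A A) != 0.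
Proof.
pose e : A -> C^o := olift (1%:M : 'M[C^o]_N).
have le : linear e by apply: olift_is_linear; exact: orthogonal_mx1.
have e1 : e 1 = 1.
  exact: (olift_is_monoid_morphism (orthogonal_mx1 C N)).1.
have be : bilinear_map (fun a b => e a * e b).
  split=> [b|a] c u w; rewrite /= le.
  - by rewrite mulrDl scalerAl.
  - by rewrite mulrDr scalerAr.
apply/eqP => /(congr1 (tlift (fun a b => e a * e b))).
rewrite [LHS](tlift_tens be) [RHS](tlift_zero be) e1 mulr1 => /eqP.
by rewrite oner_eq0.
Qed.

HB.instance Definition _ :=
  GRing.PzSemiRing_isNonZero.Build (tensor A A) OON2_1neq0.
HB.instance Definition _ :=
  GRing.Lmodule_isLalgebra.Build C (tensor A A) (@tensor_scaleAl C A A).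
HB.instance Definition _ :=
  GRing.Lalgebra_isAlgebra.Build C (tensor A A) (@tensor_scaleAr C A A).
HB.instance Definition _ := hasStar.Build C (tensor A A)
  (@tstarK C A A) (@tstarD C A A) (@tstarZ C A A) (@tstarM C A A).

Definition comult_gen : 'M[tensor A A]_N :=
  \matrix_(i, j) \sum_k tens (ogen C N i k) (ogen C N k j).

Lemma tens_suml (I : Type) (r : seq I) (F : I -> A) (b : A) :
  tens (\sum_(i <- r) F i) b = \sum_(i <- r) tens (F i) b.
Proof.
apply: (big_morph (fun a => tens a b)) => [u w|].
  exact: (bilinDl (tens_bilinear A A)).
exact: (bilin0l (tens_bilinear A A)).
Qed.

Lemma tens_sumr (I : Type) (r : seq I) (F : I -> A) (a : A) :
  tens a (\sum_(i <- r) F i) = \sum_(i <- r) tens a (F i).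
Proof.
apply: (big_morph (tens a)) => [u w|].
  exact: (bilinDr (tens_bilinear A A)).
exact: (bilin0r (tens_bilinear A A)).
Qed.

Lemma tens_nat (b c : bool) :
  tens (b%:R : A) (c%:R : A) = (b && c)%:R :> tensor A A.
Proof.
case: b; case: c => //=; rewrite ?(bilin0l (tens_bilinear A A))//.
exact: (bilin0r (tens_bilinear A A)).
Qed.

Lemma comult_gen_orthogonal : orthogonal_mx comult_gen.
Proof.
have [g1 g2 g3] := ogen_orthogonal C N.
split=> i j.
- rewrite mxE star_sum; apply: eq_bigr => k _.
  by rewrite [LHS]tstar_tens !g1.
- under eq_bigr do rewrite !mxE mulr_suml.
  under eq_bigr do under eq_bigr do rewrite mulr_sumr.
  rewrite exchange_big/=.
  under eq_bigr do rewrite exchange_big/=.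
  transitivity (\sum_(k < N) \sum_(l < N)
     tens (ogen C N i k * ogen C N j l) ((k == l)%:R : A)).
    apply: eq_bigr => k _; apply: eq_bigr => l _.
    by rewrite -g2 tens_sumr; apply: eq_bigr => m _; rewrite [LHS]tmul_tens.
  transitivity (tens (\sum_(k < N) ogen C N i k * ogen C N j k) (1 : A)).
    rewrite tens_suml; apply: eq_bigr => k _.
    rewrite (bigD1 k)//= eqxx big1 ?addr0// => l lk.
    by rewrite eq_sym (negPf lk) (bilin0r (tens_bilinear A A)).
  by rewrite g2 (tens_nat _ true) andbT.
- under eq_bigr do rewrite !mxE mulr_suml.
  under eq_bigr do under eq_bigr do rewrite mulr_sumr.
  rewrite exchange_big/=.
  under eq_bigr do rewrite exchange_big/=.
  transitivity (\sum_(k < N) \sum_(l < N)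
     tens ((k == l)%:R : A) (ogen C N k i * ogen C N l j)).
    apply: eq_bigr => k _; apply: eq_bigr => l _.
    by rewrite -g3 tens_suml; apply: eq_bigr => m _; rewrite [LHS]tmul_tens.
  transitivity (tens (1 : A) (\sum_(k < N) ogen C N k i * ogen C N k j)).
    rewrite tens_sumr; apply: eq_bigr => k _.
    rewrite (bigD1 k)//= eqxx big1 ?addr0// => l lk.
    by rewrite eq_sym (negPf lk) (bilin0l (tens_bilinear A A)).
  by rewrite g3 (tens_nat true).
Qed.

Definition comult : A -> tensor A A := olift comult_gen.

Lemma comult_ogen i j :
  comult (ogen C N i j) = \sum_k tens (ogen C N i k) (ogen C N k j).
Proof. by rewrite /comult (olift_gen comult_gen_orthogonal) mxE. Qed.

Lemma comult_morphism :
  [/\ linear comult, monoid_morphism comult & star_morphism comult].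
Proof.
have o := comult_gen_orthogonal.
split; [exact: olift_is_linear | exact: olift_is_monoid_morphism|].
exact: olift_is_star_morphism.
Qed.

End OON2.

(* The multiplication is a plain operation because mathcomp-analysis has no     *)
(* structure joining normed modules and rings.                                 *)
Record cstarAlgebra (R : realType) := CStarAlgebra {
  csort :> completeNormedModType R[i];
  cone : csort;
  cmul : csort -> csort -> csort;
  cstar : csort -> csort;
  cmulA : associative cmul;
  cmul1x : left_id cone cmul;
  cmulx1 : right_id cone cmul;
  cmul_linearl : forall y, linear (cmul^~ y);
  cmul_linearr : forall x, linear (cmul x);
  cstarK : involutive cstar;
  cstar_antilinear : forall (c : R[i]) (x y : csort),
    cstar (c *: x + y) = Num.conj c *: cstar x + cstar y;
  cstarM : forall x y, cstar (cmul x y) = cmul (cstar y) (cstar x);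
  cnormM : forall x y, `|cmul x y| <= `|x| * `|y|;
  cnorm_star : forall x, `|cmul (cstar x) x| = `|x| ^+ 2
}.

Definition star_hom_to_cstar (R : realType) (A : starAlgType R[i])
    (B : cstarAlgebra R) (f : A -> B) :=
  [/\ linear f, f 1 = cone B, forall x y, f (x * y) = cmul (f x) (f y)
    & forall x, f (star x) = cstar (f x)].

Definition cstar_hom (R : realType) (B D : cstarAlgebra R) (g : B -> D) :=
  [/\ linear g, g (cone B) = cone D,
      forall x y, g (cmul x y) = cmul (g x) (g y)
    & forall x, g (cstar x) = cstar (g x)].

(* A *-homomorphism g between C*-algebras is automatically continuous, so by   *)
(* density of the range of iota it is determined by its values on that range.  *)
Definition enveloping_cstar (R : realType) (A : starAlgType R[i])
    (B : cstarAlgebra R) (iota : A -> B) :=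
  [/\ star_hom_to_cstar iota, dense (range iota)
    & forall (D : cstarAlgebra R) (f : A -> D), star_hom_to_cstar f ->
        exists2 g : B -> D, cstar_hom g & forall x, g (iota x) = f x].

Definition cstar_extension (R : realType) (A : starAlgType R[i])
    (B : cstarAlgebra R) (iota : A -> B)
    (phi : {linear A -> R[i]^o}) (F : {linear B -> R[i]^o}) :=
  continuous F /\ forall x, F (iota x) = phi x.

(* `|x| takes values in R[i], where it is real; hence the real part.           *)
Definition dual_norm (R : realType) (B : normedModType R[i])
    (F : B -> R[i]^o) : R :=
  sup [set complex.Re `|F x| | x in [set x : B | `|x| <= 1]].

Definition half_fs_dist (R : realType) (B : cstarAlgebra R)
    (F G : B -> R[i]^o) : R := 2^-1 * dual_norm (F \- G).

Definition state (C : numClosedFieldType) (A : starAlgType C)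
    (phi : {linear A -> C^o}) :=
  phi 1 = 1 /\ forall x, (0 : C) <= phi (star x * x).

(* P_n(x): P_0 = 1, P_1 = X and X P_n = P_(n+1) + P_(n-1). *)
Fixpoint cheb (A : nzRingType) (x : A) (n : nat) : A :=
  match n with
  | 0 => 1
  | m.+1 => match m with
            | 0 => x
            | k.+1 => x * cheb x m - cheb x k
            end
  end.

Section QuantumGroup.
Variables (C : numClosedFieldType) (N : nat).
Local Notation A := (OON C N).

Definition id_tensor (phi : A -> C^o) : tensor A A -> A :=
  tlift (fun a b => (phi b : C) *: a).
Definition tensor_id (phi : A -> C^o) : tensor A A -> A :=
  tlift (fun a b => (phi a : C) *: b).
Definition convolution (phi psi : A -> C^o) (x : A) : C^o :=
  tlift (fun a b => phi a * psi b) (comult x).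

Lemma id_tensor_bilinear (phi : {linear A -> C^o}) :
  bilinear_map (fun a b : A => (phi b : C) *: a : A).
Proof.
split=> [b|a] c u w /=.
- by rewrite scalerDr !scalerA mulrC.
- by rewrite linearP scalerDl scalerA.
Qed.

Lemma tensor_id_bilinear (phi : {linear A -> C^o}) :
  bilinear_map (fun a b : A => (phi a : C) *: b : A).
Proof.
split=> [b|a] c u w /=.
- by rewrite linearP scalerDl scalerA.
- by rewrite scalerDr !scalerA mulrC.
Qed.

Lemma convolution_bilinear (phi psi : {linear A -> C^o}) :
  bilinear_map (fun a b : A => phi a * psi b : C^o).
Proof.
split=> [b|a] c u w /=; rewrite linearP.
- by rewrite mulrDl scalerAl.
- by rewrite mulrDr scalerAr.
Qed.

Definition haar_state (h : {linear A -> C^o}) :=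
  [/\ state h, forall x, id_tensor h (comult x) = (h x : C)%:A
    & forall x, tensor_id h (comult x) = (h x : C)%:A].

Definition star_mx (d : nat) (v : 'M[A]_d) : 'M[A]_d := (map_mx star v)^T.

Definition unitary_rep (d : nat) (v : 'M[A]_d) :=
  [/\ forall i j, comult (v i j) = \sum_k tens (v i k) (v k j),
      v *m star_mx v = 1%:M & star_mx v *m v = 1%:M].

Definition irreducible_rep (d : nat) (v : 'M[A]_d) :=
  (0 < d)%N /\ forall T : 'M[C]_d,
    map_mx (in_alg A) T *m v = v *m map_mx (in_alg A) T -> is_scalar_mx T.

Definition chi (n : nat) : A := cheb (\sum_i ogen C N i i) n.

Definition qdim (n : nat) : C := (cheb 'X n : {poly C}).[N%:R].

(* v is a representative of the class u^n, which is determined by its character. *)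
Definition irrep (n d : nat) (v : 'M[A]_d) :=
  [/\ unitary_rep v, irreducible_rep v & \tr v = chi n].

Definition in_characters (x : A) :=
  exists (m : nat) (c : nat -> C), x = \sum_(n < m) c n *: chi n.

Definition character_expectation (E : {linear A -> A}) :=
  [/\ forall x, in_characters (E x),
      forall x, in_characters x -> E x = x,
      forall x y, in_characters x -> E (x * y) = x * E y /\ E (y * x) = E y * x
    & forall (n d : nat) (v : 'M[A]_d) (i j : 'I_d), irrep n v ->
        E (v i j) = ((i == j)%:R / qdim n) *: chi n].

(* Linear forms on the character algebra are restrictions of linear forms on A. *)
Definition central (phi : {linear A -> C^o}) :=
  exists2 E : {linear A -> A}, character_expectation E
    & exists phi' : {linear A -> C^o}, forall x, phi x = phi' (E x).

End QuantumGroup.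

Section Brownian.
Variables (R : realType) (N : nat).

Definition bm_rate (n : nat) : R :=
  (cheb 'X n : {poly R})^`().[N%:R] / (cheb 'X n : {poly R}).[N%:R].

Definition brownian_motion (psi : R -> {linear OON R[i] N -> R[i]^o}) :=
  (forall t, 0 <= t ->
    [/\ state (psi t), central (psi t)
      & forall n, psi t (chi R[i] N n) =
          ((cheb 'X n : {poly R}).[N%:R] * expR (- (t * bm_rate n)))%:C]) /\
  (forall s t, 0 <= s -> 0 <= t ->
    forall x, psi (s + t) x = convolution (psi s) (psi t) x).

End Brownian.

Definition cutoff_time (R : realType) (N : nat) : R := N%:R * ln N%:R.

(* Main.v *)
(* Idea. Let rho = N e^(-t/N), which is N^(-eps) or N^eps at t = (1 +/- eps) N ln N.

   Upper bound. For x in O(O_N^+), (psi_t - h)(x) = h(z x) where z is the sum of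
   psi_t(chi_n) chi_n over 1 <= n <= m and m is the degree of E(x). By
   Cauchy-Schwarz |(psi_t - h)(x)| <= |z|_2 |x|, and |z|_2^2 is at most the sum of
   rho^(2n), because P_n(N) <= N^n and P_n'(N)/P_n(N) >= n/N.

   Lower bound. Under h the element X = chi_1 has second moment 1, and under psi_t
   it has mean rho and variance at most 1. The elements (cos(pi/n) + i sin(pi/n)
   X/rho)^n, which approximate exp(i pi X/rho), have norm tending to 1 as n grows;
   their values are within O(1/rho) of 1 under h and of -1 under psi_t.

   Representation theory. The representations u^n are built by recursion:
   u^n (x) u contains u^(n-1), and the complement has character chi_(n+1). For
   such a v, the matrix h(v) is an idempotent fixed by M = psi_1(v). Since
   tr M^k = psi_k(chi_n) = d r^k with r < 1 for n >= 1, the matrix M does not have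
   the eigenvalue 1, so h(v) = 0. Hence the chi_n are orthonormal for h, the u^n
   are irreducible, and h o E = h. *)

Require Import Defs.
From mathcomp Require Import all_boot all_order all_algebra.
From mathcomp Require Import complex mxtens.
From mathcomp Require Import all_classical all_reals all_analysis.
From mathcomp Require Import ring lra.

Set Implicit Arguments.
Unset Strict Implicit.
Unset Printing Implicit Defensive.

Import Order.TTheory GRing.Theory Num.Theory.
Import numFieldNormedType.Exports.

Local Open Scope classical_set_scope.
Local Open Scope complex_scope.
Local Open Scope ring_scope.

(** * Chebyshev polynomials *)

Lemma chebSS (A : nzRingType) (x : A) n :
  cheb x n.+2 = x * cheb x n.+1 - cheb x n.
Proof. by []. Qed.

Lemma cheb_horner (A : comNzRingType) (x : A) n :
  (cheb 'X n : {poly A}).[x] = cheb x n.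
Proof.
elim/ltn_ind: n => -[|[|n]] IH; rewrite /= ?hornerC ?hornerX//.
by rewrite -!/(cheb _ _.+1) hornerD hornerN hornerM hornerX !IH.
Qed.

Lemma cheb_deriv_rec (A : comNzRingType) (x : A) n :
  (cheb 'X n.+2 : {poly A})^`().[x] =
  cheb x n.+1 + x * (cheb 'X n.+1 : {poly A})^`().[x]
    - (cheb 'X n : {poly A})^`().[x].
Proof.
by rewrite chebSS derivB derivM derivX mul1r !hornerE cheb_horner.
Qed.

Section ChebyshevBounds.
Variables (R : realFieldType) (x : R).

(** Positivity and growth go together: P_(n+2) - P_(n+1) = (x - 2) P_(n+1) + (P_(n+1) - P_n). *)
Lemma cheb_ge1_incr n : 2 <= x -> 1 <= cheb x n /\ cheb x n <= cheb x n.+1.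
Proof.
move=> x2; elim: n => [|n [IH1 IH2]]; first by split; [exact: lexx|change (1 <= x); lra].
rewrite chebSS; split; first by lra.
have : 0 <= (x - 2) * cheb x n.+1 by apply: mulr_ge0; lra.
lra.
Qed.

Lemma cheb_ge1 n : 2 <= x -> 1 <= cheb x n.
Proof. by move=> /cheb_ge1_incr-/(_ n) []. Qed.

Lemma cheb_le_expr n : 2 <= x -> cheb x n <= x ^+ n.
Proof.
move=> x2; elim: n => [|n IH]; first by rewrite expr0.
case: n IH => [|n] IH; first by rewrite expr1.
rewrite chebSS exprS.
have := cheb_ge1 n x2; have : 0 <= x by lra.
move=> x0 h; have := ler_wpM2l x0 IH; lra.
Qed.

(** [e k] is the defect in P_k'/P_k >= k/x. It satisfies the Chebyshev recursion with the extra
    source 2 P_n >= 0, so it grows from e_0 = e_1 = 0. *)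
Lemma cheb_deriv_lower_incr n : 2 <= x ->
  let e k := x * (cheb 'X k : {poly R})^`().[x] - k%:R * cheb x k in
  0 <= e n /\ e n <= e n.+1.
Proof.
move=> x2 e; elim: n => [|n [IH1 IH2]].
  have -> : e 0 = 0 by rewrite /e [cheb _ 0]/(1) derivC horner0 mulr0 mul0r subrr.
  have -> : e 1 = 0 by rewrite /e [cheb _ 1]/('X) derivX hornerC mulr1 mul1r subrr.
  by rewrite lexx.
have -> : e n.+2 = x * e n.+1 - e n + 2 * cheb x n.
  by rewrite /e cheb_deriv_rec chebSS -!(natr1 n) -(natr1 n.+1) -natr1; ring.
have := cheb_ge1 n x2.
have : 0 <= (x - 2) * e n.+1 by apply: mulr_ge0; lra.
by split; lra.
Qed.

Lemma cheb_log_deriv_ge n : 2 <= x ->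
  n%:R / x <= (cheb 'X n : {poly R})^`().[x] / (cheb 'X n : {poly R}).[x].
Proof.
move=> x2; rewrite cheb_horner.
have a1 := cheb_ge1 n x2; have [/= e0 _] := cheb_deriv_lower_incr n x2.
rewrite ler_pdivrMr; last by lra.
rewrite mulrAC ler_pdivlMr; last by lra.
by rewrite mulrC; lra.
Qed.

End ChebyshevBounds.

Section ExpBounds.
Variables (R : realType) (N : nat).
Hypothesis N2 : (2 <= N)%N.

Lemma bm_rate_ge n : n%:R / N%:R <= bm_rate R N n.
Proof. by apply: cheb_log_deriv_ge; rewrite (ler_nat _ 2). Qed.

Lemma bm_value_bound (t : R) n : 0 <= t ->
  0 <= (cheb 'X n : {poly R}).[N%:R] * expR (- (t * bm_rate R N n))
    <= (N%:R * expR (- (t / N%:R))) ^+ n.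
Proof.
move=> t0; have N2' : 2 <= N%:R :> R by rewrite (ler_nat _ 2).
rewrite cheb_horner; have a1 := cheb_ge1 n N2'.
apply/andP; split; first by rewrite mulr_ge0 ?expR_ge0//; lra.
rewrite exprMn ler_pM ?expR_ge0//; [lra|exact: cheb_le_expr|].
rewrite -expRM_natr ler_expR mulNr lerN2 -mulrA ler_wpM2l//.
by rewrite mulrC bm_rate_ge.
Qed.

End ExpBounds.

(** * Traces of idempotent matrices *)

Section IdempotentTrace.
Variable C : numFieldType.

(** In the full-rank factorisation P = C R idempotency forces R C = 1, an identity matrix of size
    rank P, and tr(C R) = tr(R C). *)
Lemma trace_idem n (P : 'M[C]_n) : P *m P = P -> \tr P = (\rank P)%:R.
Proof.
move=> PP; rewrite -{1}(mulmx_base P) mxtrace_mulC.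
suff -> : row_base P *m col_base P = 1%:M by rewrite mxtrace1.
apply: (row_free_inj (row_base_free P)); apply: (row_full_inj (col_base_full P)).
by rewrite mul1mx mulmx_base -mulmxA mulmx_base mulmxA mulmx_base PP.
Qed.

Lemma idem_tr0 n (P : 'M[C]_n) : P *m P = P -> \tr P = 0 -> P = 0.
Proof.
move=> PP /eqP; rewrite trace_idem// pnatr_eq0 mxrank_eq0 => /eqP//.
Qed.

(* The generalised eigenprojection of M at 1 is a polynomial p(M) that may be   *)
(* chosen with p(0) = p(r) = 0, and such polynomials have trace d p(r) = 0.     *)
Lemma fixed_mx_eq0 n (M Q : 'M[C]_n) (d r : C) : r != 1 ->
  (forall k, \tr (iter k.+1 (mulmx M) 1%:M) = d * r ^+ k.+1) ->
  M *m Q = Q -> Q = 0.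
Proof.
move=> r1 trM MQ.
case: n M Q trM MQ => [|n] M Q trM MQ; first by apply/matrixP => -[].
have trX k : \tr (M ^+ k.+1) = d * r ^+ k.+1.
  rewrite -trM; congr (\tr _); elim: k.+1 => [|k' IH]; first by rewrite expr0.
  by rewrite exprS IH.
have [a [g g1 gE]] := multiplicity_XsubC (char_poly M) 1.
have {}g1 : ~~ root g 1.
  by apply: contraTN g1 => ->; rewrite implybF negbK monic_neq0 ?char_poly_monic.
(* The factors X and X - r make [p] vanish at 0 and r. The exponent [a.+1] makes [L] vanish at 1
   even when [a = 0], which gives p(1) = 1. *)
pose G := 'X * ('X - r%:P) * g.
pose L : {poly C} := ('X - 1%:P) ^+ a.+1.
have cop : coprimep L G.
  apply: coprimep_expl; rewrite coprimep_sym coprimep_XsubC /G !rootM.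
  by rewrite !negb_or root_XsubC eq_sym r1 g1 rootE hornerX oner_eq0.
have [[al be] /= bez] := Bezout_eq1_coprimepP _ _ cop.
pose p := be * G.
pose hm (q : {poly C}) := horner_mx M q.
have hmD q1 q2 : hm (q1 + q2) = hm q1 + hm q2 by rewrite /hm rmorphD.
have hmM q1 q2 : hm (q1 * q2) = hm q1 * hm q2 by rewrite /hm rmorphM.
have LG0 : hm (L * G) = 0.
  rewrite (_ : L * G = ('X - 1%:P) * 'X * ('X - r%:P) * char_poly M).
    by rewrite hmM /hm Cayley_Hamilton mulr0.
  by rewrite gE /L /G exprS; ring.
(* By Bezout p (1 - p) is a multiple of L G, which Cayley-Hamilton kills at M. *)
have pidem : hm p * hm p = hm p.
  have -> : hm p * hm p = hm p - hm (p * (1 - p)).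
    have hm1 : hm 1 = 1 by rewrite /hm rmorph1.
    have hmB q1 q2 : hm (q1 - q2) = hm q1 - hm q2 by rewrite /hm rmorphB.
    by rewrite (hmM p) hmB hm1 mulrBr mulr1 opprB addrC subrK.
  rewrite (_ : p * (1 - p) = al * be * (L * G)); last first.
    by rewrite -bez /p; ring.
  by rewrite (hmM (al * be)) LG0 mulr0 subr0.
have trp (q : {poly C}) : q.[0] = 0 -> \tr (hm q) = d * q.[r].
  rewrite horner_coef0 => q0; rewrite /hm -{1}[q]coefK poly_def horner_coef.
  rewrite rmorph_sum /= raddf_sum mulr_sumr /=; apply: eq_bigr => i _.
  rewrite linearZ /= mxtraceZ rmorphXn /= horner_mx_X.
  by case: (i : nat) => [|k]; rewrite ?q0 ?mul0r ?mulr0// trX mulrCA.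
have hp0 : hm p = 0.
  have pid : (hm p) *m (hm p) = hm p := pidem.
  apply: (idem_tr0 pid).
  have pr : p.[r] = 0 by rewrite /p /G !hornerM hornerXsubC subrr mulr0 mul0r mulr0.
  have p0 : p.[0] = 0 by rewrite /p /G !hornerM hornerX !mul0r mulr0.
  by rewrite trp// pr mulr0.
have hpQ (q : {poly C}) : hm q *m Q = q.[1] *: Q.
  elim/poly_ind: q => [|q c IH]; first by rewrite /hm rmorph0 horner0 mul0mx scale0r.
  rewrite hmD hmM {2 3}/hm horner_mx_X horner_mx_C mulmxDl -mulmxA MQ IH.
  by rewrite mul_scalar_mx -scalerDl !hornerE.
have p1 : p.[1] = 1.
  have /(congr1 (horner^~ 1)) := bez.
  by rewrite hornerD /L !hornerE subrr expr0n /= mulr0 add0r => ->.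
by have := hpQ p; rewrite hp0 mul0mx p1 scale1r.
Qed.

End IdempotentTrace.

(** * States and C*-norms *)

Lemma starN (C : numClosedFieldType) (A : starAlgType C) (x : A) :
  star (- x) = - star x.
Proof. by rewrite -scaleN1r starZ rmorphN1 scaleN1r. Qed.

Lemma starB (C : numClosedFieldType) (A : starAlgType C) (x y : A) :
  star (x - y) = star x - star y.
Proof. by rewrite starD starN. Qed.

Section States.
Variables (C : numClosedFieldType) (A : starAlgType C).
Variable phi : {linear A -> C^o}.
Hypothesis phi_pos : forall x, (0 : C) <= phi (star x * x).

Local Notation form a b := (phi (star a * b) : C).

Lemma form_expand (x y : A) (l : C) :
  form (x + l *: y) (x + l *: y) =
  form x x + l * form x y + l^* * form y x + l * l^* * form y y.
Proof.
have -> : star (x + l *: y) * (x + l *: y) =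
    star x * x + l *: (star x * y) + l^* *: (star y * x) + (l * l^*) *: (star y * y).
  rewrite starD starZ mulrDl !mulrDr -!(scalerAl, scalerAr) scalerA !addrA.
  by rewrite [l^* * l]mulrC.
by rewrite !linearD !linearZ.
Qed.

(** Polarisation: the form is real at x + y and at x + i y, which gives two linear relations between
    the mixed terms and their conjugates. *)
Lemma form_conj (x y : A) : form x y = (form y x)^*.
Proof.
have re z : (form z z)^* = form z z by exact/CrealP/ger0_real/phi_pos.
have := re (x + 1 *: y); have := re (x + 'i *: y).
rewrite !form_expand !(rmorphD, rmorphM, rmorph1) /= !re !conjCK !conjCi !mul1r.
set a := form y y; set b := form y x; set b' := form x y; set c := form x x.
move=> e1 e2.
have {}e1 : - b'^* + b^* = b' - b.
  apply: (mulfI (neq0Ci C)); apply: (addrI c).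
  apply: (addIr ('i * - 'i * a)).
  rewrite !mulrDr mulrN [in RHS]mulrN -[in RHS]mulNr !addrA -[X in _ = X]e1; ring.
have {}e2 : b'^* + b^* = b' + b.
  by apply: (addrI c); apply: (addIr a); rewrite !addrA.
apply: (mulfI (_ : (2 : C) != 0)); first by rewrite pnatr_eq0.
have := congr2 +%R e1 e2.
by rewrite (_ : - b'^* + b^* + (b'^* + b^*) = 2 * b^*) 1?(_ : b' - b + (b' + b) = 2 * b'); [|ring|ring].
Qed.

Lemma state_cauchy_schwarz (x y : A) :
  `|form y x| ^+ 2 <= form y y * form x x.
Proof.
have q l := phi_pos (x + l *: y).
have a0 : 0 <= form y y := phi_pos y; have c0 : 0 <= form x x := phi_pos x.
have {}q l : 0 <= form x x + l * (form y x)^* + l^* * form y x + l * l^* * form y y.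
  by have := q l; rewrite form_expand (form_conj x y).
rewrite normCK.
move: q a0 c0; set a := form y y; set b := form y x; set c := form x x.
move=> q a0 c0.
have areal : a^* = a by exact/CrealP/ger0_real.
have creal : c^* = c by exact/CrealP/ger0_real.
have [a00|an0] := eqVneq a 0.
  rewrite a00 mul0r; have [->|bn0] := eqVneq b 0; first by rewrite mul0r.
  have bb : b * b^* != 0 by rewrite mulf_neq0// conjC_eq0.
  (* With [a = 0] the quadratic term is absent, and this choice of [l] gives the value -(c + 2) <
     0. *)
  have := q (- ((c + 1) / (b * b^*)) * b).
  rewrite !(rmorphM, rmorphN, rmorphD, rmorph1, fmorphV) /= conjCK creal a00.
  have -> : c + - ((c + 1) / (b * b^*)) * b * b^* + - ((c + 1) / (b^* * b)) * b^* * b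
     + - ((c + 1) / (b * b^*)) * b * (- ((c + 1) / (b^* * b)) * b^*) * 0 = - (c + 2).
    by field; move: bb; rewrite mulf_eq0 negb_or andbC.
  rewrite oppr_ge0 => h; have := lt_le_trans _ h.
  by move=> /(_ 0); rewrite ltxx ltr_wpDl// => /(_ isT).
have := q (- b / a).
rewrite !(rmorphM, rmorphN, fmorphV) /= areal.
have -> : c + - b / a * b^* + - b^* / a * b + - b / a * (- b^* / a) * a
   = c - b * b^* / a by field.
by rewrite subr_ge0 ler_pdivrMr ?lt_def ?an0// (mulrC a).
Qed.

End States.

Lemma bernoulli_ineq (R : realDomainType) (a : R) n :
  -1 <= a -> 1 + n%:R * a <= (1 + a) ^+ n.
Proof.
move=> a1; elim: n => [|n IH]; first by rewrite mul0r addr0 expr0.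
have a1' : 0 <= 1 + a by lra.
rewrite exprS; apply: le_trans (ler_wpM2l a1' IH).
have : 0 <= n%:R * a ^+ 2 by rewrite mulr_ge0// sqr_ge0.
by rewrite -natr1; lra.
Qed.

(** If p > q > 0, Bernoulli makes (p/q)^(2^k) grow at least linearly in 2^k, past any M. *)
Lemma le_of_pow2_le (R : realType) (M p q : R) : 0 <= q ->
  (forall k, p ^+ (2 ^ k) <= M * q ^+ (2 ^ k)) -> p <= q.
Proof.
move=> q0 H; rewrite leNgt; apply/negP => qp.
have [q00|qn0] := eqVneq q 0.
  by have := H 0; rewrite !expr1 q00 mulr0 => h; move: qp; rewrite q00; lra.
have {}q0 : 0 < q by rewrite lt_def qn0.
pose a := p / q - 1.
have a0 : 0 < a by rewrite subr_gt0 ltr_pdivlMr// mul1r.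
have {}H k : 1 + (2 ^ k)%:R * a <= M.
  apply: le_trans (bernoulli_ineq _ _) _; first by lra.
  by rewrite addrC subrK expr_div_n ler_pdivrMr ?exprn_gt0.
pose k := Num.truncn (M / a).
have Mk : M / a < (2 ^ k)%:R.
  apply: lt_le_trans (truncnS_gt _) _.
  by rewrite ler_nat ltn_expl.
have := H k; rewrite ltr_pdivrMr// in Mk; lra.
Qed.

Section ComplexNorm.
Variable R : realType.

Lemma realcD (x y : R) : (x + y)%:C = x%:C + y%:C.
Proof. exact: rmorphD. Qed.

Lemma realcM (x y : R) : (x * y)%:C = x%:C * y%:C.
Proof. exact: rmorphM. Qed.

Lemma realcX (x : R) n : (x ^+ n)%:C = x%:C ^+ n.
Proof. exact: rmorphXn. Qed.

Lemma norm_realcE (V : normedModType R[i]) (v : V) :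
  `|v| = (complex.Re `|v|)%:C.
Proof. by rewrite RRe_real; last exact: normr_real. Qed.

Lemma Re_norm_ge0 (V : normedModType R[i]) (v : V) : 0 <= complex.Re `|v|.
Proof. by rewrite -ler0c -norm_realcE. Qed.

Lemma Re_norm_le (V W : normedModType R[i]) (v : V) (w : W) :
  (complex.Re `|v| <= complex.Re `|w|) = (`|v| <= `|w|).
Proof. by rewrite -lecR -!norm_realcE. Qed.

End ComplexNorm.

Section DualNorm.
Variables (R : realType) (V : normedModType R[i]).

Lemma dual_norm_le (D : V -> R[i]^o) (d : R) : 0 <= d ->
  (forall b, `|D b| <= d%:C * `|b|) -> dual_norm D <= d.
Proof.
move=> d0 H; apply: ge_sup.
  by exists (complex.Re `|D 0|); exists 0 => //=; rewrite normr0.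
move=> _ [x x1 <-]; rewrite -lecR -norm_realcE (le_trans (H x))//.
by rewrite ler_piMr// ler0c.
Qed.

(** The bound by [d] makes the set in [dual_norm] bounded above, so that its [sup] is a true
    supremum and not a default value. *)
Lemma le_dual_norm (D : {linear V -> R[i]^o}) (d K : R) (b : V) : 0 <= d -> 0 < K ->
  (forall b, `|D b| <= d%:C * `|b|) -> `|b| <= K%:C ->
  complex.Re `|D b| <= dual_norm D * K.
Proof.
move=> d0 K0 H bK.
have KC : 0 < K%:C by rewrite ltcR.
have DK : D b = K%:C *: D (K%:C^-1 *: b).
  by rewrite linearZ /= scalerA divff ?scale1r// gt_eqF.
rewrite -lecR -norm_realcE DK normrZ gtr0_norm// realcM mulrC ler_wpM2r//; first exact: ltW.
rewrite norm_realcE lecR.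
apply: ub_le_sup; last first.
  exists (K%:C^-1 *: b) => //=.
  by rewrite normrZ normfV gtr0_norm// ler_pdivrMl// mulr1.
exists d => _ [x x1 <-]; rewrite -lecR -norm_realcE (le_trans (H x))//.
by rewrite ler_piMr// ler0c.
Qed.

End DualNorm.

Section CstarStates.
Variables (R : realType) (A : starAlgType R[i]) (B : cstarAlgebra R).
Variable iota : A -> B.
Hypothesis iota_hom : star_hom_to_cstar iota.

Lemma cstar_norm_star x : `|iota (star x * x)| = `|iota x| ^+ 2.
Proof. by have [_ _ iM iS] := iota_hom; rewrite iM iS cnorm_star. Qed.

Lemma cstar_norm_mul x y : `|iota (x * y)| <= `|iota x| * `|iota y|.
Proof. by have [_ _ iM _] := iota_hom; rewrite iM cnormM. Qed.

Lemma cstar_norm_add x y : `|iota (x + y)| <= `|iota x| + `|iota y|.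
Proof.
have [il _ _ _] := iota_hom.
by have := il 1 x y; rewrite !scale1r => ->; exact: ler_normD.
Qed.

Lemma cstar_hom0 : iota 0 = 0.
Proof.
have [il _ _ _] := iota_hom.
by have := il (-1) 0 0; rewrite !scaleN1r !addNr.
Qed.

Lemma cstar_norm_scale c x : `|iota (c *: x)| = `|c| * `|iota x|.
Proof.
have [il _ _ _] := iota_hom.
by have := il c x 0; rewrite cstar_hom0 !addr0 => ->; exact: normrZ.
Qed.

Lemma cstar_norm1 : `|iota 1| <= 1.
Proof.
have := cstar_norm_star 1; rewrite star1 mulr1.
have [->|n0] := eqVneq `|iota 1| 0; first by rewrite ler01.
by rewrite expr2 -{1}[`|iota 1|]mulr1 => /(mulfI n0) <-.
Qed.

Lemma cstar_extension_bounded (phi : {linear A -> R[i]^o}) (F : {linear B -> R[i]^o}) :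
  cstar_extension iota phi F ->
  exists2 M : R, 0 < M & forall b, `|F b| <= M%:C * `|b|.
Proof.
move=> [/linear_bounded_continuous/linear_boundedP/pinfty_ex_gt0 [M M0 H] _].
have MR := RRe_real (gtr0_real M0).
by exists (complex.Re M); [rewrite -ltcR MR|rewrite MR].
Qed.

(* By Cauchy-Schwarz and the C*-identity, a bound |phi x| <= M |x| for all x    *)
(* improves to |phi x| <= M^(1/2^k) |x|.                                        *)
Lemma state_contractive (phi : {linear A -> R[i]^o}) (F : {linear B -> R[i]^o}) x :
  state phi -> cstar_extension iota phi F -> `|phi x| <= `|iota x|.
Proof.
move=> [phi1 phi_pos] ext; have [M M0 HM] := cstar_extension_bounded ext.
rewrite -Re_norm_le; apply: (@le_of_pow2_le _ M); first exact: Re_norm_ge0.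
move=> k; rewrite -lecR realcM !realcX -!norm_realcE.
elim: k x => [|k IH] x; first by rewrite expn0 !expr1 -ext.2; exact: HM.
rewrite expnS !exprM -cstar_norm_star; apply: le_trans (IH (star x * x)).
rewrite lerXn2r ?nnegrE ?exprn_ge0//.
have := state_cauchy_schwarz phi_pos x 1.
rewrite star1 !mul1r phi1 mul1r => /le_trans; apply.
by rewrite real_ler_norm// ger0_real.
Qed.

Lemma dense_bound (phi psi : {linear A -> R[i]^o}) (F G : {linear B -> R[i]^o})
    (d : R) :
  dense (range iota) -> cstar_extension iota phi F -> cstar_extension iota psi G ->
  0 <= d -> (forall x, `|phi x - psi x| <= d%:C * `|iota x|) ->
  forall b, `|F b - G b| <= d%:C * `|b|.
Proof.
move=> dns extF extG d0 H b.
have [M M0 HM] := cstar_extension_bounded extF.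
have [K K0 HK] := cstar_extension_bounded extG.
apply/ler_addgt0Pr => e e0.
(* M + K + d is the total coefficient of |b - iota x| in the final estimate, so the radius e / (M +
   K + d) keeps the error below e. *)
have c0 : 0 < (M + K + d)%:C by rewrite ltcR; lra.
have r0 : 0 < e / (M + K + d)%:C by rewrite divr_gt0.
have [y [/interior_subset yb [x _ xy]]] :
    (ball b (e / (M + K + d)%:C))^° `&` range iota !=set0.
  apply: dns; last exact: open_interior.
  by exists b; exact: nbhsx_ballx.
move: yb; rewrite -{y}xy -ball_normE /= => bx.
have -> : F b - G b = F (b - iota x) - G (b - iota x) + (phi x - psi x).
  rewrite -extF.2 -extG.2 !linearB /=.
  have id3 (p q r s : R[i]) : p - q = p - r + (- q - - s) + (r - s) by ring.
  exact: id3.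
have xb : `|iota x| <= `|b| + `|b - iota x|.
  by rewrite (le_trans _ (ler_normB b (b - iota x)))// subKr.
apply: le_trans (ler_normD _ _) _; apply: le_trans (lerD (ler_normB _ _) (H x)) _.
apply: (@le_trans _ _ (M%:C * `|b - iota x| + K%:C * `|b - iota x|
   + d%:C * (`|b| + `|b - iota x|))).
  by rewrite !lerD// ler_wpM2l// ler0c.
rewrite mulrDr addrCA lerD2l -!mulrDl -!realcD.
by apply: ltW; rewrite mulrC -ltr_pdivlMr.
Qed.

Section TwoStates.
Variables (phi psi : {linear A -> R[i]^o}) (F G : {linear B -> R[i]^o}).
Hypotheses (dns : dense (range iota)) (phi_state : state phi) (psi_state : state psi).
Hypotheses (extF : cstar_extension iota phi F) (extG : cstar_extension iota psi G).

Lemma half_fs_dist_le (d : R) : 0 <= d ->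
  (forall x, `|phi x - psi x| <= d%:C * `|iota x|) -> half_fs_dist F G <= d / 2.
Proof.
move=> d0 H; rewrite /half_fs_dist mulrC ler_pM2r ?invr_gt0//.
by apply: dual_norm_le => // b; exact: (dense_bound dns extF extG).
Qed.

Lemma state_dist_le2 x : `|phi x - psi x| <= 2%:C * `|iota x|.
Proof.
apply: le_trans (ler_normB _ _) _; rewrite [2%:C](_ : _ = 1 + 1); last first.
  by rewrite realcD rmorph1.
by rewrite mulrDl !mul1r lerD//; [exact: state_contractive extF|exact: state_contractive extG].
Qed.

Lemma half_fs_dist_le1 : half_fs_dist F G <= 1.
Proof.
have -> : (1 : R) = 2 / 2 by rewrite divff// pnatr_eq0.
by apply: half_fs_dist_le => //; exact: state_dist_le2.
Qed.

Lemma half_fs_dist_ge (K : R) x : 0 < K -> `|iota x| <= K%:C ->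
  complex.Re `|phi x - psi x| <= 2 * half_fs_dist F G * K.
Proof.
move=> K0 xK; rewrite /half_fs_dist mulrA divff ?pnatr_eq0// mul1r -extF.2 -extG.2.
apply: (@le_dual_norm _ _ [the {linear B -> R[i]^o} of F \- G] 2) => //= b.
by apply: (dense_bound dns extF extG) => //; exact: state_dist_le2.
Qed.

End TwoStates.

End CstarStates.

(** * Separating two states by a rotation *)

Section Trigonometry.
Variable R : realType.

Lemma sin_le_id (x : R) : 0 <= x -> sin x <= x.
Proof.
rewrite le_eqVlt => /predU1P[<-|x0]; first by rewrite sin0.
have [c _] : exists2 c, c \in `]0, x[%R & sin x - sin 0 = cos c * (x - 0).
  apply: MVT => //.
  by apply: continuous_subspaceT => y; exact: continuous_sin.
rewrite sin0 !subr0 => ->; by rewrite ler_piMl ?cos_le1// ltW.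
Qed.

Lemma de_moivre (x : R) n :
  (cos x +i* sin x) ^+ n = cos (n%:R * x) +i* sin (n%:R * x).
Proof.
elim: n => [|n IH]; first by rewrite expr0 mul0r cos0 sin0.
rewrite exprS IH -natr1 mulrDl mul1r addrC cosD sinD.
by apply/eqP; rewrite eq_complex /=; apply/andP; split; apply/eqP; ring.
Qed.

(** Since 0 <= cos x <= 1, cos^n is at least (cos^2)^n = (1 - sin^2)^n; Bernoulli and sin x <= x
    finish. *)
Lemma cos_pow_lower (x : R) n : 0 <= x <= pi / 2 -> 1 - n%:R * x ^+ 2 <= cos x ^+ n.
Proof.
move=> /andP[x0 x1].
have c0 : 0 <= cos x by apply: cos_ge0_pihalf; rewrite x1 andbT; lra.
have s0 : 0 <= sin x by apply: sin_ge0_pi; rewrite x0 /=; have := pi_ge0 R; lra.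
have s1 := sin_le1 x; have c1 := cos_le1 x.
apply: (@le_trans _ _ ((cos x ^+ 2) ^+ n)); last first.
  by rewrite lerXn2r ?nnegrE ?exprn_ge0// expr2 ler_piMl.
rewrite cos2sin2; apply: le_trans (bernoulli_ineq _ _); last first.
  by rewrite lerN2 exprn_ile1.
rewrite mulrN lerD2l lerN2 ler_wpM2l//.
by rewrite lerXn2r ?nnegrE// sin_le_id.
Qed.

End Trigonometry.

(** (1 + b)^n (1 - b)^n <= 1, and Bernoulli bounds (1 - b)^n below by 1 - n b. *)
Lemma pow_inv_bernoulli (R : realFieldType) (b : R) n :
  0 <= b -> n%:R * b < 1 -> (1 + b) ^+ n <= (1 - n%:R * b)^-1.
Proof.
case: n => [|n] b0 nb; first by rewrite expr0 mul0r subr0 invr1.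
have b1 : b <= n.+1%:R * b by rewrite ler_peMl// ler1n.
rewrite -[leRHS]mul1r ler_pdivlMr ?subr_gt0//.
apply: (@le_trans _ _ ((1 + b) ^+ n.+1 * (1 - b) ^+ n.+1)).
  rewrite ler_wpM2l ?exprn_ge0//; first by lra.
  by have := @bernoulli_ineq R (- b) n.+1; rewrite mulrN; apply; lra.
have b2 : 0 <= b ^+ 2 by rewrite exprn_ge0.
by rewrite -exprMn exprn_ile1//; [apply: mulr_ge0; lra | lra].
Qed.

Section AffinePowers.
Variables (R : realType) (A : starAlgType R[i]) (B : cstarAlgebra R).
Variable iota : A -> B.
Hypothesis iota_hom : star_hom_to_cstar iota.

(** One factor is peeled off at a time: y^(n+1) = w y^n + mu Z y^n. The first term does not amplify
    the old error because |w| <= 1, and the second adds at most |mu| K. *)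
Lemma state_affine_pow (phi : {linear A -> R[i]^o}) (Z : A) (w mu K : R[i]) n :
  phi 1 = 1 -> `|w| <= 1 ->
  (forall k, (k < n)%N -> `|phi (Z * (w%:A + mu *: Z) ^+ k)| <= K) ->
  `|phi ((w%:A + mu *: Z) ^+ n) - w ^+ n| <= n%:R * (`|mu| * K).
Proof.
move=> phi1 w1; elim: n => [|n IH] HK.
  by rewrite !expr0 phi1 subrr normr0 mul0r.
set y := w%:A + mu *: Z in IH HK *.
have -> : phi (y ^+ n.+1) - w ^+ n.+1
    = w * (phi (y ^+ n) - w ^+ n) + mu * phi (Z * y ^+ n).
  rewrite exprS {1}/y mulrDl -!scalerAl mul1r linearD !linearZ /=.
  by rewrite exprS mulrBr addrAC.
rewrite (le_trans (ler_normD _ _))// !normrM -natr1 mulrDl mul1r lerD//; last first.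
  by rewrite ler_wpM2l// HK.
rewrite -[leRHS]mul1r ler_pM// IH// => k kn.
by apply: HK; rewrite ltnS ltnW.
Qed.

(** Cauchy-Schwarz splits off phi(Z Z) <= 1, and contractivity bounds phi at [star y * y] by the
    squared norm of y. *)
Lemma state_mul_bound (phi : {linear A -> R[i]^o}) (F : {linear B -> R[i]^o})
    (Z y : A) (K : R[i]) :
  state phi -> cstar_extension iota phi F -> star Z = Z -> phi (Z * Z) <= 1 ->
  `|iota y| <= K -> `|phi (Z * y)| <= K.
Proof.
move=> st ext sZ Z1 yK.
have K0 : 0 <= K by apply: le_trans yK.
rewrite -(@ler_sqr _ `|_|) ?nnegrE//.
have := state_cauchy_schwarz st.2 y Z; rewrite sZ => /le_trans; apply.
rewrite -[leRHS]mul1r ler_pM ?st.2//; first by rewrite -{1}sZ st.2.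
rewrite (le_trans (real_ler_norm _)) ?ger0_real ?st.2//.
rewrite (le_trans (state_contractive iota_hom _ st ext))//.
by rewrite cstar_norm_star// lerXn2r ?nnegrE.
Qed.

End AffinePowers.

(** In the application [mu] is 1/m, [k] a norm bound, [c] a power of a cosine and [e] the error of
    each state. The losses are mu from [c], 2 mu from k - 1 and 8 mu k <= 16 mu from [e + e]: 19 mu
    in all, then halved. *)
Lemma separation_arith (R : realFieldType) (f k c e mu : R) :
  1 <= k <= 1 + mu -> 0 <= mu <= 1 -> f <= 1 -> 1 - mu <= c -> e <= 4 * mu * k ->
  1 + c <= 2 * f * k + (e + e) -> 1 - 10 * mu <= f.
Proof.
move=> /andP[k1 k2] /andP[mu0 mu1] f1 c1 ek H.
have : 0 <= (1 - f) * (k - 1) by apply: mulr_ge0; lra.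
have : 0 <= mu * (1 + mu - k) by apply: mulr_ge0; lra.
have : 0 <= mu * (1 - mu) by apply: mulr_ge0; lra.
lra.
Qed.

Section StateSeparation.
Variables (R : realType) (A : starAlgType R[i]) (B : cstarAlgebra R).
Variable iota : A -> B.
Hypothesis iota_hom : star_hom_to_cstar iota.
Variables (phi h : {linear A -> R[i]^o}) (F G : {linear B -> R[i]^o}).
Hypotheses (dns : dense (range iota)) (phi_state : state phi) (h_state : state h).
Hypotheses (extF : cstar_extension iota phi F) (extG : cstar_extension iota h G).

Lemma cstar_norm_pow_le (y : A) (K : R) n k : 1 <= K -> `|iota y| <= K%:C ->
  (k <= n)%N -> `|iota (y ^+ k)| <= (K ^+ n)%:C.
Proof.
move=> K1 yK kn; apply: (@le_trans _ _ (K ^+ k)%:C); last first.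
  by rewrite lecR ler_weXn2l.
elim: k {kn} => [|k IH]; first by rewrite !expr0 (cstar_norm1 iota_hom).
rewrite !exprS (le_trans (cstar_norm_mul iota_hom _ _))// realcM.
by rewrite ler_pM.
Qed.

(** For self-adjoint X and imaginary mu the cross terms of [star y * y] cancel, which leaves c^2 +
    s^2 X^2; the C*-identity then bounds the norm. *)
Lemma cstar_norm_rotation (X : A) (c s L : R) (mu : R[i]) :
  star X = X -> 0 <= L -> `|iota X| = L%:C -> `|c| <= 1 ->
  mu^* = - mu -> - (mu * mu) = (s ^+ 2)%:C ->
  `|iota (c%:C%:A + mu *: X)| <= (1 + s ^+ 2 * L ^+ 2)%:C.
Proof.
move=> sX L0 XL c1 muJ mu2; set y := _ + _.
have yy : star y * y = (c ^+ 2)%:C *: 1 + (s ^+ 2)%:C *: (star X * X).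
  have cC : Num.conj c%:C = c%:C by exact/CrealP/complex_realP/(ex_intro _ c).
  rewrite /y starD !starZ star1 sX muJ cC mulrDl !mulrDr.
  rewrite -!(scalerAl, scalerAr) !scalerA !mul1r !mulr1 addrA -[X in X + _]addrA -scalerDl.
  have -> : c%:C * mu + - mu * c%:C = 0 by ring.
  by rewrite scale0r addr0 -realcM -expr2 mulNr mu2.
have K0 : 0 <= s ^+ 2 * L ^+ 2 by rewrite mulr_ge0 ?sqr_ge0.
have y2 : `|iota y| ^+ 2 <= (1 + s ^+ 2 * L ^+ 2)%:C.
  rewrite -cstar_norm_star// yy (le_trans (cstar_norm_add iota_hom _ _))//.
  rewrite !cstar_norm_scale// cstar_norm_star// XL -realcX.
  rewrite !ger0_norm ?ler0c ?sqr_ge0// realcD [X in _ <= _ + X]realcM lerD2r.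
  rewrite -[leRHS]mulr1 ler_pM ?ler0c ?sqr_ge0//; last exact: cstar_norm1.
  by rewrite lecR -real_normK ?num_real// exprn_ile1.
rewrite -(@ler_sqr _ `|_|) ?nnegrE ?ler0c ?addr_ge0//.
by rewrite (le_trans y2)// -realcX lecR expr2 ler_peMl ?addr_ge0// lerDl.
Qed.

Lemma state_separation (X : A) (m : R) : star X = X -> 1 <= m ->
  h (X * X) <= 1 -> phi ((X - m%:C%:A) * (X - m%:C%:A)) <= 1 ->
  1 - 10 / m <= half_fs_dist F G.
Proof.
move=> sX m1 hX phiX.
have m0 : 0 < m by lra.
have m10 : 0 < m + 1 by lra.
have p4 : (pi : R) <= 4 by have := pihalf_02 R; lra.
have p0 := pi_gt0 R.
pose L := complex.Re `|iota X|.
have L0 : 0 <= L := Re_norm_ge0 _.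
have XL : `|iota X| = L%:C := norm_realcE _.
have mi0 : 0 < m^-1 by rewrite invr_gt0; lra.
have mi1 : m^-1 <= 1 by rewrite invf_le1; lra.
pose a := pi ^+ 2 * (m^-1) ^+ 2 * L ^+ 2.
have a0 : 0 <= a by rewrite /a -!exprMn sqr_ge0.
(* K^n is about 1 + a/n, so n > a (m + 1) gives K^n <= 1 + 1/m, and n > 16 m gives pi^2/n <= 1/m.
   The [.+3] puts n above the sum and ensures [th <= pi / 2]. *)
pose n := (Num.truncn (a * (m + 1) + 16 * m)).+3.
have nR : a * (m + 1) + 16 * m < n%:R.
  by apply: lt_le_trans (truncnS_gt _) _; rewrite ler_nat /n ltnS !leqW.
have am0 : 0 <= a * (m + 1) by rewrite mulr_ge0// ltW.
have n0 : (0 : R) < n%:R by rewrite ltr0n.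
pose th : R := pi / n%:R.
have th0 : 0 <= th by rewrite divr_ge0// ltW.
have th1 : th <= pi / 2 by rewrite ler_pM2l// lef_pV2 ?posrE// ler_nat.
have nth : n%:R * th = pi by rewrite /th mulrC divfK// gt_eqF.
pose c := cos th; pose s := sin th.
have s0 : 0 <= s.
  by apply: sin_ge0_pi; rewrite th0 (le_trans th1)// ler_pdivrMr// ler_peMr ?ler1n// ltW.
have sth : s <= th by exact: sin_le_id.
(* As mu m = i sin th, replacing X by m in [y] gives w = cos th + i sin th, and w^n = -1. *)
pose mu : R[i] := 0 +i* (s * m^-1).
have muJ : Num.conj mu = - mu by apply/eqP; rewrite eq_complex /= oppr0 !eqxx.
have mu2 : - (mu * mu) = ((s * m^-1) ^+ 2)%:C.
  by apply/eqP; rewrite eq_complex /=; apply/andP; split; apply/eqP; ring.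
pose y := c%:C%:A + mu *: X.
pose K := 1 + a / n%:R ^+ 2.
have an0 : 0 <= a / n%:R ^+ 2 by rewrite divr_ge0 ?sqr_ge0.
have K1 : 1 <= K by rewrite lerDl.
have c1 : `|c| <= 1 by exact: cos_max.
have c0 : 0 <= c.
  by apply: cos_ge0_pihalf; rewrite th1 andbT (le_trans _ th0)// oppr_le0 divr_ge0// ltW.
have yK : `|iota y| <= K%:C.
  apply: le_trans (cstar_norm_rotation sX L0 XL c1 muJ mu2) _; rewrite lecR lerD2l.
  have -> : a / n%:R ^+ 2 = th ^+ 2 * m^-1 ^+ 2 * L ^+ 2.
    by rewrite /a /th expr_div_n; ring.
  by rewrite exprMn !ler_wpM2r ?sqr_ge0// lerXn2r ?nnegrE.
have Kn : K ^+ n <= 1 + m^-1.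
  have na : n%:R * (a / n%:R ^+ 2) = a / n%:R by field; rewrite gt_eqF.
  have am : a / n%:R <= (m + 1)^-1.
    rewrite ler_pdivrMr// mulrC ler_pdivlMr//.
    by apply/ltW/(le_lt_trans _ nR); rewrite lerDl mulr_ge0// ltW.
  have mm : (m + 1)^-1 < 1 by rewrite invf_lt1// ltrDr.
  apply: le_trans (pow_inv_bernoulli _ _) _; rewrite ?na//; first exact: le_lt_trans mm.
  apply: (@le_trans _ _ (1 - (m + 1)^-1)^-1).
    by rewrite lef_pV2 ?posrE ?lerD2l ?lerN2// subr_gt0// (le_lt_trans am).
  rewrite le_eqVlt; apply/orP; left; apply/eqP; field.
  by rewrite !gt_eqF.
have yk k : (k < n)%N -> `|iota (y ^+ k)| <= (K ^+ n)%:C.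
  by move=> kn; apply: cstar_norm_pow_le => //; exact: ltnW.
have muE : `|mu| = (s / m)%:C.
  have sm0 : 0 <= s * m^-1 by rewrite mulr_ge0// ltW.
  rewrite normc_def; congr (_%:C); rewrite [complex.Re mu]/(0) [complex.Im mu]/(s * m^-1).
  by rewrite expr0n add0r sqrtr_sqr ger0_norm.
(* Under [h] the powers of y are expanded around X = 0, with base point cos th; under [phi] they are
   expanded around X = m, with base point w. *)
have hy : `|h (y ^+ n) - c%:C ^+ n| <= n%:R * (`|mu| * (K ^+ n)%:C).
  apply: state_affine_pow h_state.1 _ _.
    by rewrite ger0_norm ?ler0c// lecR cos_le1.
  move=> k kn; apply: state_mul_bound extG _ _ _ => //; exact: yk.
pose w : R[i] := c +i* s.
have w1 : `|w| = 1 by rewrite normc_def /= cos2Dsin2 sqrtr1.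
have wn : w ^+ n = -1.
  rewrite /w de_moivre nth cospi sinpi; apply/eqP.
  by rewrite eq_complex /= oppr0 !eqxx.
have yw : y = w%:A + mu *: (X - m%:C%:A).
  have -> : w = c%:C + mu * m%:C.
    apply/eqP; rewrite eq_complex /= !mulr0 mul0r subr0 !addr0 add0r eqxx /=.
    by rewrite add0r divfK// gt_eqF.
  rewrite scalerDl scalerBr scalerA /y -addrA; congr (_ + _).
  by rewrite addrCA subrr addr0.
have phiy : `|phi (y ^+ n) - w ^+ n| <= n%:R * (`|mu| * (K ^+ n)%:C).
  rewrite yw; apply: state_affine_pow phi_state.1 _ _; first by rewrite w1.
  rewrite -yw => k kn; apply: state_mul_bound extF _ _ _ => //; last exact: yk.
  have mC : Num.conj m%:C = m%:C by exact/CrealP/complex_realP/(ex_intro _ m).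
  by rewrite starB sX starZ star1 mC.
have := half_fs_dist_ge iota_hom dns phi_state h_state extF extG
  (exprn_gt0 n (lt_le_trans ltr01 K1)) (cstar_norm_pow_le K1 yK (leqnn n)).
(* The defect is n th^2 = pi^2/n <= 16/n <= 1/m. *)
have cn : 1 - m^-1 <= c ^+ n.
  apply: le_trans (cos_pow_lower n _); last by rewrite th0.
  rewrite lerD2l lerN2 expr2 mulrA nth /th mulrA ler_pdivrMr// ler_pdivlMl//.
  apply/ltW/(le_lt_trans _ nR); rewrite -[leLHS]add0r lerD// mulrC.
  have -> : (16 : R) = 4 * 4 by rewrite -natrM.
  apply: ler_wpM2r; first exact: ltW.
  by apply: ler_pM => //; exact: ltW.
have ns : n%:R * (s / m * K ^+ n) <= 4 * m^-1 * K ^+ n.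
  have K0 : 0 <= K ^+ n by rewrite exprn_ge0// (le_trans ler01).
  have -> : n%:R * (s / m * K ^+ n) = n%:R * s * (m^-1 * K ^+ n) by rewrite !mulrA.
  rewrite -[leRHS]mulrA; apply: ler_wpM2r; first by rewrite mulr_ge0// ltW.
  by apply: le_trans p4; rewrite -nth; apply: ler_wpM2l.
move=> dist; apply: (@separation_arith _ _ (K ^+ n) (c ^+ n)
  (n%:R * (s / m * K ^+ n)) m^-1) => //.
- by rewrite Kn exprn_ege1.
- by rewrite mi1 ltW.
- exact: (half_fs_dist_le1 iota_hom dns phi_state h_state extF extG).
move: hy phiy; rewrite muE -realcM -[n%:R](rmorph_nat (real_complex R)) -realcM wn => hy phiy.
rewrite -lecR !realcD.
apply: le_trans (lerD (_ : (complex.Re `|phi (y ^+ n) - h (y ^+ n)|)%:C <= _) (lerD phiy hy)); last by rewrite lecR.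
rewrite -norm_realcE.
have -> : (1 + (c ^+ n)%:C : R[i]) = `| (phi (y ^+ n) - h (y ^+ n)) - (phi (y ^+ n) - -1) + (h (y ^+ n) - c%:C ^+ n)|.
  have -> : phi (y ^+ n) - h (y ^+ n) - (phi (y ^+ n) - -1) + (h (y ^+ n) - c%:C ^+ n) = - (1 + (c ^+ n)%:C).
    rewrite realcX.
    have id4 (p q c' : R[i]) : p - q - (p - -1) + (q - c') = - (1 + c') by ring.
    exact: id4.
  by rewrite normrN ger0_norm// addr_ge0// ler0c exprn_ge0.
rewrite [leRHS]addrA (le_trans (ler_normD _ _))// lerD2r.
exact: ler_normB.
Qed.

End StateSeparation.

(** * Representations with character chi_n *)

Lemma mxtens_ind m n (P : 'I_(m * n) -> Prop) :
  (forall i j, P (mxtens_index (i, j))) -> forall p, P p.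
Proof. by move=> H p; rewrite -[p]mxtens_unindexK; case: (mxtens_unindex p). Qed.

Lemma sum_mxtens (V : nmodType) m n (F : 'I_(m * n) -> V) :
  \sum_p F p = \sum_i \sum_j F (mxtens_index (i, j)).
Proof.
rewrite pair_bigA /= (reindex (@mxtens_index m n)).
  by apply: eq_bigr => -[i j].
by exists (@mxtens_unindex m n) => p _; rewrite (mxtens_indexK, mxtens_unindexK).
Qed.

Lemma tr_tensmx (R : nzRingType) m n (A : 'M[R]_m) (B : 'M[R]_n) :
  \tr (A *t B) = \tr A * \tr B.
Proof.
rewrite /mxtrace sum_mxtens mulr_suml; apply: eq_bigr => i _.
by rewrite mulr_sumr; apply: eq_bigr => j _; rewrite tensmxE.
Qed.

Section UnitaryMatrices.
Local Open Scope sesquilinear_scope.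

Lemma trmxConjE (C : numClosedFieldType) m n (M : 'M[C]_(m, n)) i j :
  (M ^t*) i j = (M j i)^*.
Proof. by rewrite mxE mxE. Qed.

(** Gram-Schmidt on a row basis of P gives S with orthonormal rows and the row space of P, and W is
    the adjoint of S. From S P = S and self-adjointness, P W = W, hence W S = P W S = P. *)
Lemma isometry_of_projection (C : numClosedFieldType) n (P : 'M[C]_n) :
  P *m P = P -> P ^t* = P ->
  exists d (W : 'M[C]_(n, d)), W ^t* *m W = 1%:M /\ W *m W ^t* = P.
Proof.
move=> PP PH.
have [d [S [SS SP]]] : exists d (S : 'M[C]_(d, n)), S *m S ^t* = 1%:M /\ (S :=: P)%MS.
  exists (\rank P), (schmidt (row_base P)); split.
    by apply/unitarymxP; rewrite schmidt_unitarymx ?rank_leq_col.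
  exact: eqmx_trans (eqmx_schmidt_free (row_base_free P)) (eq_row_base P).
have SPS : S *m P = S.
  have /submxP[D ->] : (S <= P)%MS by rewrite SP.
  by rewrite -mulmxA PP.
have PSS : P *m S ^t* *m S = P.
  have /submxP[D PE] : (P <= S)%MS by rewrite SP.
  by rewrite {1}PE -(mulmxA D) SS mulmx1 -PE.
exists d, (S ^t*); rewrite trmxCK; split=> //.
transitivity (P *m S ^t* *m S); last exact: PSS.
congr (_ *m _).
by rewrite -[in LHS]SPS trmx_mul map_mxM /= PH.
Qed.

End UnitaryMatrices.

Section StarMatrices.
Local Open Scope sesquilinear_scope.
Variables (C : numClosedFieldType) (A : starAlgType C).

Definition adjmx m n (X : 'M[A]_(m, n)) : 'M[A]_(n, m) := (map_mx star X)^T.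
Definition scmx m n (M : 'M[C]_(m, n)) : 'M[A]_(m, n) := map_mx (in_alg A) M.

Lemma adjmxE m n (X : 'M[A]_(m, n)) i j : adjmx X i j = star (X j i).
Proof. by rewrite /adjmx mxE mxE. Qed.

Lemma scmxE m n (M : 'M[C]_(m, n)) i j : scmx M i j = (M i j)%:A.
Proof. by rewrite /scmx mxE. Qed.

Lemma mx1E n (i j : 'I_n) : (1%:M : 'M[A]_n) i j = (i == j)%:R.
Proof. by rewrite mxE. Qed.

Lemma mxmulE m n p (X : 'M[A]_(m, n)) (Y : 'M[A]_(n, p)) i j :
  (X *m Y) i j = \sum_k X i k * Y k j.
Proof. by rewrite mxE. Qed.

Lemma scmxM m n p (M : 'M[C]_(m, n)) (M' : 'M[C]_(n, p)) :
  scmx (M *m M') = scmx M *m scmx M'.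
Proof. exact: map_mxM. Qed.

Lemma scmx1 n : scmx (1%:M : 'M[C]_n) = 1%:M.
Proof. exact: map_mx1. Qed.

Lemma scmxB m n (M M' : 'M[C]_(m, n)) : scmx (M - M') = scmx M - scmx M'.
Proof. exact: map_mxB. Qed.

Lemma star_alg (c : C) : star (c%:A : A) = (c^*)%:A.
Proof. by rewrite starZ star1. Qed.

Lemma adjmx_scmx m n (M : 'M[C]_(m, n)) : adjmx (scmx M) = scmx (M ^t*).
Proof. by apply/matrixP => i j; rewrite !mxE star_alg. Qed.

Lemma adjmxM m n p (X : 'M[A]_(m, n)) (Y : 'M[A]_(n, p)) :
  adjmx (X *m Y) = adjmx Y *m adjmx X.
Proof.
apply/matrixP => i j; rewrite !mxE star_sum; apply: eq_bigr => k _.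
by rewrite !mxE starM.
Qed.

Lemma scalar_comm (c : C) (x : A) : c%:A * x = x * c%:A.
Proof. by rewrite -scalerAl mul1r -scalerAr mulr1. Qed.

(** Cyclicity of the trace fails over the noncommutative A, but survives when one factor has scalar,
    hence central, entries. *)
Lemma tr_scmxC m n (M : 'M[C]_(m, n)) (X : 'M[A]_(n, m)) :
  \tr (scmx M *m X) = \tr (X *m scmx M).
Proof.
rewrite /mxtrace; under eq_bigr do rewrite mxE.
rewrite exchange_big /=; apply: eq_bigr => i _; rewrite mxE.
by apply: eq_bigr => j _; rewrite mxE scalar_comm.
Qed.

(** The adjoint of X T = T Y is multiplied by Y on the left and by X on the right. *)
Lemma unitary_intertwiner_adj m n (T : 'M[C]_(m, n)) (X : 'M[A]_m) (Y : 'M[A]_n) :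
  adjmx X *m X = 1%:M -> Y *m adjmx Y = 1%:M ->
  X *m scmx T = scmx T *m Y -> scmx (T ^t*) *m X = Y *m scmx (T ^t*).
Proof.
move=> XX YY XT; have := congr1 (fun Z : 'M[A]_(m, n) => Y *m adjmx Z *m X) XT.
by rewrite !adjmxM !adjmx_scmx -!mulmxA XX mulmx1 !mulmxA YY mul1mx => ->.
Qed.

End StarMatrices.

(** * Unitary corepresentations: tensor products and compressions *)

Section Corepresentations.
Local Open Scope sesquilinear_scope.
Variables (C : numClosedFieldType) (N : nat).
Local Notation A := (OON C N).
Local Notation u := (ogen C N).

Definition corep d (v : 'M[A]_d) :=
  forall i j, comult (v i j) = \sum_k tens (v i k) (v k j).

Lemma comultM (x y : A) : comult (x * y) = comult x * comult y.
Proof. by have [_ [_ ->]] := comult_morphism C N. Qed.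

Lemma comult_lin (c : C) (x y : A) : comult (c *: x + y) = c *: comult x + comult y.
Proof. by have [-> _] := comult_morphism C N. Qed.

Lemma comult1 : comult (1 : A) = tens 1 1.
Proof. by have [_ [-> _]] := comult_morphism C N. Qed.

Lemma comult0 : comult (0 : A) = 0.
Proof. by have := comult_lin (-1) 0 0; rewrite !scaleN1r !addNr. Qed.

Lemma comult_star (x : A) : comult (star x) = star (comult x).
Proof. by have [_ _ ->] := comult_morphism C N. Qed.

Lemma comult_sum (I : Type) (r : seq I) (F : I -> A) :
  comult (\sum_(i <- r) F i) = \sum_(i <- r) comult (F i).
Proof.
apply: (big_morph (@comult C N)) => [x y|]; last exact: comult0.
by have := comult_lin 1 x y; rewrite !scale1r.
Qed.

Lemma comultZ (c : C) (x : A) : comult (c *: x) = c *: comult x.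
Proof. by have := comult_lin c x 0; rewrite comult0 !addr0. Qed.

Lemma corep_gen : corep u.
Proof. exact: comult_ogen. Qed.

Lemma corep_tens d e (v : 'M[A]_d) (w : 'M[A]_e) :
  corep v -> corep w -> corep (v *t w).
Proof.
move=> cv cw p q; elim/mxtens_ind: p => i j; elim/mxtens_ind: q => k l.
rewrite tensmxE comultM cv cw mulr_suml sum_mxtens; apply: eq_bigr => a _.
rewrite mulr_sumr; apply: eq_bigr => b _.
by rewrite !tensmxE; exact: tmul_tens.
Qed.

Lemma corep_star d (v : 'M[A]_d) : corep v -> corep (map_mx star v).
Proof.
move=> cv i j; rewrite mxE comult_star cv star_sum; apply: eq_bigr => k _.
by rewrite !mxE; exact: tstar_tens.
Qed.

Lemma unitary_rep_gen : unitary_rep u.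
Proof.
have [g1 g2 g3] := ogen_orthogonal C N.
split; first exact: corep_gen.
  apply/matrixP => i j; rewrite mxmulE mx1E -g2; apply: eq_bigr => k _.
  by rewrite [X in _ * X]adjmxE g1.
apply/matrixP => i j; rewrite mxmulE mx1E -g3; apply: eq_bigr => k _.
by rewrite [X in X * _]adjmxE g1.
Qed.

Lemma unitary_rep1 : unitary_rep (1%:M : 'M[A]_1).
Proof.
split.
- by move=> i j; rewrite !ord1 big_ord1 !mxE eqxx comult1.
- by rewrite mul1mx; apply/matrixP => i j; rewrite !mxE !ord1 eqxx star1.
- by rewrite mulmx1; apply/matrixP => i j; rewrite !mxE !ord1 eqxx star1.
Qed.

(** The entries do not commute, so the inner pair has to collapse first: the sum over the w-index in
    one relation, over the v-index in the other. *)
Lemma unitary_rep_tens d e (v : 'M[A]_d) (w : 'M[A]_e) :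
  unitary_rep v -> unitary_rep w -> unitary_rep (v *t w).
Proof.
move=> [cv v1 v2] [cw w1 w2]; split; first exact: corep_tens.
- apply/matrixP => p q; elim/mxtens_ind: p => i j; elim/mxtens_ind: q => k l.
  rewrite mxE sum_mxtens.
  transitivity (\sum_a v i a * (\sum_b w j b * star (w l b)) * star (v k a)).
    apply: eq_bigr => a _; rewrite mulr_sumr mulr_suml; apply: eq_bigr => b _.
    by rewrite tensmxE !mxE !mxtens_indexK /= starM !mulrA.
  have -> : \sum_b w j b * star (w l b) = (j == l)%:R.
    move/matrixP/(_ j l): w1; rewrite !mxE => <-.
    by apply: eq_bigr => b _; rewrite !mxE.
  rewrite mxE (can_eq (@mxtens_indexK d e)) xpair_eqE.
  case: (j == l); last first.
    by rewrite andbF big1// => a _; rewrite mulr0 mul0r.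
  rewrite andbT; move/matrixP/(_ i k): v1; rewrite !mxE => <-.
  by apply: eq_bigr => a _; rewrite !mxE mulr1.
- apply/matrixP => p q; elim/mxtens_ind: p => i j; elim/mxtens_ind: q => k l.
  rewrite mxE sum_mxtens exchange_big /=.
  transitivity (\sum_b star (w b j) * (\sum_a star (v a i) * v a k) * w b l).
    apply: eq_bigr => b _; rewrite mulr_sumr mulr_suml; apply: eq_bigr => a _.
    by rewrite tensmxE !mxE !mxtens_indexK /= starM !mulrA.
  have -> : \sum_a star (v a i) * v a k = (i == k)%:R.
    move/matrixP/(_ i k): v2; rewrite !mxE => <-.
    by apply: eq_bigr => b _; rewrite !mxE.
  rewrite mxE (can_eq (@mxtens_indexK d e)) xpair_eqE.
  case: (i == k); last first.
    by rewrite big1// => a _; rewrite mulr0 mul0r.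
  rewrite /=; move/matrixP/(_ j l): w2; rewrite !mxE => <-.
  by apply: eq_bigr => a _; rewrite !mxE mulr1.
Qed.

(** The range of W is invariant under V, and v is the restriction of V to it. *)
Lemma unitary_rep_compress D d (V : 'M[A]_D) (W : 'M[C]_(D, d)) :
  unitary_rep V -> W ^t* *m W = 1%:M ->
  V *m scmx A (W *m W ^t*) = scmx A (W *m W ^t*) *m V ->
  let v := scmx A (W ^t*) *m V *m scmx A W in
  [/\ unitary_rep v, V *m scmx A W = scmx A W *m v
    & scmx A (W ^t*) *m V = v *m scmx A (W ^t*)].
Proof.
move=> [cV V1 V2] WW VP v.
have VW : V *m scmx A W = scmx A W *m v.
  by rewrite /v !mulmxA -scmxM -VP -mulmxA -scmxM -mulmxA WW mulmx1.
have WV : scmx A (W ^t*) *m V = v *m scmx A (W ^t*).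
  by rewrite /v -mulmxA -scmxM -mulmxA VP scmxM !mulmxA -scmxM WW scmx1 mul1mx.
have av : adjmx v = scmx A (W ^t*) *m adjmx V *m scmx A W.
  by rewrite /v !adjmxM !adjmx_scmx trmxCK mulmxA.
split=> //; split.
- move=> i j.
  have vE x y : v x y = \sum_a (\sum_b scmx A (W ^t*) x b * V b a) * scmx A W a y.
    by rewrite mxE; apply: eq_bigr => a _; rewrite mxE.
  have vij : v i j = \sum_a \sum_b (((W a i)^* * W b j) *: V a b).
    rewrite vE exchange_big /=; apply: eq_bigr => b _.
    rewrite mulr_suml; apply: eq_bigr => a _; rewrite !mxE.
    by rewrite -scalerAl mul1r -scalerAl -scalerAr mulr1 scalerA.
  rewrite vij comult_sum.
  transitivity (\sum_a \sum_c tens ((W a i)^* *: V a c) ((V *m scmx A W) c j)).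
    apply: eq_bigr => a _; rewrite comult_sum.
    transitivity (\sum_b \sum_c tens ((W a i)^* *: V a c) (W b j *: V c b)).
      apply: eq_bigr => b _; rewrite comultZ cV scaler_sumr; apply: eq_bigr => c _.
      by rewrite (bilinZl (tens_bilinear A A)) (bilinZr (tens_bilinear A A)) scalerA.
    rewrite exchange_big /=; apply: eq_bigr => c _.
    rewrite mxE tens_sumr; apply: eq_bigr => b _.
    by rewrite mxE -scalerAr mulr1.
  (* V W = W v introduces the summation index k of v; the scalars [W c k] then move to the left leg
     and complete [v i k]. *)
  rewrite VW.
  transitivity (\sum_a \sum_k \sum_c tens ((W a i)^* *: V a c) (W c k *: v k j)).
    apply: eq_bigr => a _; rewrite exchange_big /=; apply: eq_bigr => c _.
    rewrite mxE tens_sumr; apply: eq_bigr => k _.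
    by rewrite mxE -scalerAl mul1r.
  rewrite exchange_big /=; apply: eq_bigr => k _.
  rewrite exchange_big /= [X in _ = tens X _]vE tens_suml; apply: eq_bigr => c _.
  rewrite mulr_suml tens_suml; apply: eq_bigr => a _.
  rewrite !mxE (bilinZr (tens_bilinear A A)) -(bilinZl (tens_bilinear A A)).
  by rewrite -scalerAl mul1r -scalerAr mulr1.
- change (v *m adjmx v = 1%:M); have V1' : V *m adjmx V = 1%:M := V1.
  by rewrite av !mulmxA -WV -(mulmxA _ V (adjmx V)) V1' mulmx1 -scmxM WW scmx1.
- change (adjmx v *m v = 1%:M); have V2' : adjmx V *m V = 1%:M := V2.
  by rewrite av -mulmxA -VW !mulmxA -(mulmxA _ (adjmx V)) V2' mulmx1 -scmxM WW scmx1.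
Qed.

End Corepresentations.

(** * Recursive construction of representations with character chi_n *)

Section Fusion.
Local Open Scope sesquilinear_scope.
Variables (C : numClosedFieldType) (N : nat).
Hypothesis N2 : (2 <= N)%N.
Local Notation A := (OON C N).
Local Notation u := (ogen C N).

(* v and w represent u^n and u^(n+1), W is an isometric intertwiner from w to   *)
(* the tensor product of v and u, and r is the partial trace of its range       *)
(* projection over the second tensor factor.                                    *)
Definition fusion_step n d e (v : 'M[A]_d) (w : 'M[A]_e)
    (W : 'M[C]_(d * N, e)) (r : C) :=
  [/\ unitary_rep v /\ \tr v = chi C N n,
      unitary_rep w /\ \tr w = chi C N n.+1,
      W ^t* *m W = 1%:M,
      scmx A (W ^t*) *m (v *t u) = w *m scmx A (W ^t*)
    & (forall b b', \sum_k \sum_a W (mxtens_index (b, k)) a *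
          (W (mxtens_index (b', k)) a)^* = r *+ (b == b')) /\ 1 <= r].

Lemma tr_ogen : \tr u = chi C N 1.
Proof. by []. Qed.

Lemma chi_comm n : chi C N n.+1 * chi C N 1 = chi C N 1 * chi C N n.+1.
Proof.
suff H m : GRing.comm (chi C N m) (chi C N 1) by exact: H.
elim/ltn_ind: m => -[|[|m]] IH; [exact/commr_sym/commr1| by []|].
rewrite /chi chebSS; apply: commr_sym; apply: commrB.
  by apply: commrM => //; apply/commr_sym/IH.
by apply/commr_sym/IH.
Qed.

Definition base_isometry : 'M[C]_(1 * N, N) :=
  \matrix_(p, a) ((mxtens_unindex p).2 == a)%:R.

Lemma base_isometryE i k a : base_isometry (mxtens_index (i, k)) a = (k == a)%:R.
Proof. by rewrite mxE mxtens_indexK. Qed.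

Lemma fusion_base : fusion_step 0 (1%:M : 'M[A]_1) u base_isometry N%:R.
Proof.
split.
- by split; [exact: unitary_rep1|rewrite mxtrace1].
- by split; [exact: unitary_rep_gen|exact: tr_ogen].
- apply/matrixP => a b; rewrite mxE sum_mxtens big_ord1 (bigD1 a)//= big1 => [|k ka].
    by rewrite trmxConjE !base_isometryE eqxx conjC1 mul1r addr0 mxE.
  by rewrite trmxConjE !base_isometryE (negPf ka) conjC0 mul0r.
- apply/matrixP => a; elim/mxtens_ind => i k; rewrite (ord1 i) [LHS]mxE [RHS]mxE.
  rewrite sum_mxtens big_ord1 (bigD1 a)//= big1 => [|l la]; last first.
    by rewrite scmxE trmxConjE base_isometryE (negPf la) conjC0 scale0r mul0r.
  rewrite (bigD1 k)//= big1 => [|l lk]; last first.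
    by rewrite scmxE trmxConjE base_isometryE eq_sym (negPf lk) conjC0 scale0r mulr0.
  rewrite tensmxE !scmxE !trmxConjE.
  by rewrite !base_isometryE !eqxx conjC1 scale1r mulr1 mul1r mx1E eqxx mul1r !addr0.
- split; last by rewrite ler1n; exact: leq_trans N2.
  move=> b b'; rewrite !ord1 eqxx mulr1n.
  rewrite -[X in X%:R](card_ord N) -sumr_const; apply: eq_bigr => k _.
  rewrite (bigD1 k)//= big1 => [|l lk]; rewrite !base_isometryE ?eqxx ?conjC1 ?mulr1 ?addr0//.
  by rewrite eq_sym (negPf lk) mul0r.
Qed.

Section Step.
Variables (n d e : nat) (v : 'M[A]_d) (w : 'M[A]_e) (W : 'M[C]_(d * N, e)) (r : C).
Hypothesis st : fusion_step n v w W r.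

(* Frobenius reciprocity: bending one leg of W gives an embedding of v into     *)
(* the tensor product of w and u.                                               *)
Definition bent_isometry : 'M[C]_(e * N, d) :=
  \matrix_(p, a) ((sqrtC r)^-1 *
     (W (mxtens_index (a, (mxtens_unindex p).2)) (mxtens_unindex p).1)^*).

Lemma bent_isometryE b k a :
  bent_isometry (mxtens_index (b, k)) a =
  (sqrtC r)^-1 * (W (mxtens_index (a, k)) b)^*.
Proof. by rewrite mxE mxtens_indexK. Qed.

Let r1 : 1 <= r. Proof. by have [_ _ _ _ []] := st. Qed.
Let r0 : 0 < r. Proof. exact: lt_le_trans r1. Qed.
Let sr_real : (sqrtC r)^* = sqrtC r.
Proof. by apply/CrealP/ger0_real; rewrite sqrtC_ge0 ltW. Qed.

(** The partial trace of the range projection of W is r times the identity, which the factor 1 /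
    [sqrtC r] normalises. *)
Lemma bent_isometry_iso : bent_isometry ^t* *m bent_isometry = 1%:M.
Proof.
have [_ _ _ _ [pt _]] := st.
apply/matrixP => a a'; rewrite mxE sum_mxtens exchange_big /=.
transitivity (r^-1 * \sum_k \sum_b W (mxtens_index (a, k)) b *
    (W (mxtens_index (a', k)) b)^*).
  rewrite mulr_sumr; apply: eq_bigr => k _; rewrite mulr_sumr; apply: eq_bigr => b _.
  rewrite trmxConjE !bent_isometryE.
  rewrite rmorphM /= conjCK fmorphV /= sr_real mulrACA -invfM.
  by rewrite -expr2 sqrtCK.
by rewrite pt mxE; case: (a == a'); rewrite ?mulVf ?mulr0// gt_eqF.
Qed.

(** The intertwining relation of W is multiplied on the right by entries of u, and the orthogonality
    of the rows of u cancels the two factors u. *)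
Lemma bent_isometry_intertwine :
  (w *t u) *m scmx A bent_isometry = scmx A bent_isometry *m v.
Proof.
have [_ _ _ int _] := st; have [_ g2 _] := ogen_orthogonal C N.
apply/matrixP => + a; elim/mxtens_ind => b k.
rewrite mxmulE sum_mxtens mxmulE.
transitivity (\sum_l ((sqrtC r)^-1)%:A *
    (\sum_b' w b b' * scmx A (W ^t*) b' (mxtens_index (a, l))) * u k l).
  rewrite exchange_big /=; apply: eq_bigr => l _.
  rewrite mulr_sumr mulr_suml; apply: eq_bigr => b' _.
  rewrite tensmxE !scmxE bent_isometryE trmxConjE.
  by rewrite !(mulr_algl, mulr_algr) scalerA scalerAl.
have wW l : \sum_b' w b b' * scmx A (W ^t*) b' (mxtens_index (a, l)) =
    \sum_a' \sum_l' ((W (mxtens_index (a', l')) b)^*)%:A * (v a' a * u l' l).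
  have /matrixP/(_ b (mxtens_index (a, l))) := int.
  rewrite !mxmulE => <-; rewrite sum_mxtens; apply: eq_bigr => a' _.
  by apply: eq_bigr => l' _; rewrite tensmxE scmxE trmxConjE.
under eq_bigr do rewrite wW.
transitivity (\sum_a' \sum_l' (((sqrtC r)^-1 * (W (mxtens_index (a', l')) b)^*)%:A
    * v a' a) * \sum_l u l' l * u k l).
  under [RHS]eq_bigr do under eq_bigr do rewrite mulr_sumr.
  under [RHS]eq_bigr do rewrite exchange_big.
  rewrite [RHS]exchange_big /=; apply: eq_bigr => l _.
  rewrite mulr_sumr mulr_suml; apply: eq_bigr => a' _.
  rewrite mulr_sumr mulr_suml; apply: eq_bigr => l' _.
  by rewrite !mulr_algl scalerA -!scalerAl mulrA.
apply: eq_bigr => a' _; rewrite (bigD1 k)//= [X in _ + X]big1 => [|l' lk]; last first.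
  by rewrite g2 (negPf lk) mulr0.
by rewrite g2 eqxx mulr1 addr0 scmxE bent_isometryE.
Qed.

(** The bent copy of v is split off from [w *t u]; the complement has character chi_(n+1) chi_1 -
    chi_n = chi_(n+2). *)
Lemma fusion_next :
  exists e' (w' : 'M[A]_e') (W' : 'M[C]_(e * N, e')) r',
    fusion_step n.+1 w w' W' r' /\
    w *t u = scmx A W' *m w' *m scmx A (W' ^t*)
           + scmx A bent_isometry *m v *m scmx A (bent_isometry ^t*).
Proof.
have [[vr vt] [wr wt] WW int [pt _]] := st.
pose T := bent_isometry; have TT : T ^t* *m T = 1%:M := bent_isometry_iso.
pose V := w *t u.
have Vr : unitary_rep V by apply: unitary_rep_tens => //; exact: unitary_rep_gen.
have [_ V1 V2] := Vr; have [_ v1 v2] := vr.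
have VT : V *m scmx A T = scmx A T *m v := bent_isometry_intertwine.
have TV : scmx A (T ^t*) *m V = v *m scmx A (T ^t*).
  exact: unitary_intertwiner_adj V2 v1 VT.
have TTC : T *m T ^t* *m (T *m T ^t*) = T *m T ^t*.
  by rewrite -mulmxA (mulmxA _ T) TT mul1mx.
have TTH : (T *m T ^t*) ^t* = T *m T ^t*.
  by rewrite trmx_mul map_mxM trmxCK.
have [||e' [W' [W'W' W'P]]] := @isometry_of_projection C _ (1%:M - T *m T ^t*).
- by rewrite mulmxBl mul1mx mulmxBr mulmx1 TTC subrr subr0.
- by rewrite linearB /= map_mxB trmx1 map_mx1 TTH.
have VTT : V *m scmx A (T *m T ^t*) = scmx A (T *m T ^t*) *m V.
  by rewrite scmxM mulmxA VT -!mulmxA TV.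
have VW'W' : V *m scmx A (W' *m W' ^t*) = scmx A (W' *m W' ^t*) *m V.
  by rewrite W'P scmxB scmx1 mulmxBr mulmxBl mulmx1 mul1mx VTT.
have [w'r VW' W'V] := unitary_rep_compress Vr W'W' VW'W'.
set w' := scmx A (W' ^t*) *m V *m scmx A W' in w'r VW' W'V.
have w't : \tr w' = chi C N n.+2.
  rewrite -tr_scmxC mulmxA -scmxM W'P scmxB scmx1 mulmxBl mul1mx linearB /=.
  rewrite scmxM -mulmxA tr_scmxC TV -mulmxA -scmxM TT scmx1 mulmx1 vt.
  by rewrite tr_tensmx wt tr_ogen chi_comm.
(* The partial trace of 1 is N, and that of the range projection of T is 1/r because W is an
   isometry; N >= 2 and r >= 1 keep the difference at least 1. *)
exists e', w', W', (N%:R - r^-1); split; last first.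
  rewrite -/T -VW' -VT -(mulmxA V (scmx A W')) -(mulmxA V (scmx A T)) -!scmxM W'P.
  by rewrite -mulmxDr scmxB subrK scmx1 mulmx1.
split=> //.
split; last first.
  have N2' : 2 <= N%:R :> C by rewrite (ler_nat _ 2).
  have : r^-1 <= 1 by rewrite invf_le1.
  by move=> ri; rewrite lerBrDr (le_trans _ N2')// [leRHS](_ : _ = 1 + 1) ?lerD2l// -natrD.
move=> b b'.
have W'W'E p q : \sum_a W' p a * (W' q a)^* = (p == q)%:R - \sum_a T p a * (T q a)^*.
  have /matrixP/(_ p q) := W'P; rewrite !mxE => e1.
  transitivity ((W' *m W' ^t*) p q).
    by rewrite mxE; apply: eq_bigr => a _; rewrite trmxConjE.
  by rewrite mxE e1; congr (_ - _); apply: eq_bigr => a _; rewrite trmxConjE.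
under eq_bigr do rewrite W'W'E.
rewrite sumrB; have -> : \sum_k \sum_a T (mxtens_index (b, k)) a *
    (T (mxtens_index (b', k)) a)^* = r^-1 *+ (b == b').
  transitivity (r^-1 * (W ^t* *m W) b b').
    rewrite mxE sum_mxtens exchange_big /= mulr_sumr; apply: eq_bigr => a _.
    rewrite mulr_sumr; apply: eq_bigr => k _.
    rewrite trmxConjE !bent_isometryE rmorphM /= conjCK fmorphV /= sr_real.
    by rewrite mulrACA -invfM -expr2 sqrtCK.
  by rewrite WW mxE mulr_natr.
rewrite mulrnBl; congr (_ - _).
under eq_bigr do rewrite (can_eq (@mxtens_indexK e N)) xpair_eqE eqxx andbT.
by rewrite sumr_const card_ord -mulrnA mulnC mulrnA.
Qed.

End Step.
End Fusion.

(** * Matrix coefficients span the whole algebra *)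

Section Spanning.
Variables (C : numClosedFieldType) (N : nat).
Hypothesis N2 : (2 <= N)%N.
Local Notation A := (OON C N).
Local Notation u := (ogen C N).

(** A chain remembers that the lower representation of each step is the upper one of the previous
    step, so that the coefficients of both lie in [rep_span]. *)
Inductive fusion_chain : nat -> forall d e,
    'M[A]_d -> 'M[A]_e -> 'M[C]_(d * N, e) -> C -> Prop :=
  | FusionBase : fusion_chain 0 (1%:M : 'M[A]_1) u (base_isometry C N) N%:R
  | FusionNext n d e e' (v : 'M[A]_d) (w : 'M[A]_e) (W : 'M[C]_(d * N, e)) r
      (w' : 'M[A]_e') (W' : 'M[C]_(e * N, e')) r' :
      fusion_chain n v w W r -> fusion_step n.+1 w w' W' r' ->
      fusion_chain n.+1 w w' W' r'.

Lemma fusion_chain_step n d e (v : 'M[A]_d) (w : 'M[A]_e) W r :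
  fusion_chain n v w W r -> fusion_step n v w W r.
Proof. by case=> *; [exact: fusion_base|]. Qed.

Lemma character_rep_exists n :
  exists d (v : 'M[A]_d), unitary_rep v /\ \tr v = chi C N n.
Proof.
suff [d [e [v [w [W [r [? _ _ _ _]]]]]]] : exists d e v w W r,
    @fusion_step C N n d e v w W r by exists d, v.
elim: n => [|n [d [e [v [w [W [r st]]]]]]].
  by do 6 eexists; exact: fusion_base.
by have [e' [w' [W' [r' [st' _]]]]] := fusion_next N2 st; do 6 eexists; exact: st'.
Qed.

Definition subspace (L : A -> Prop) :=
  forall (c : C) x y, L x -> L y -> L (c *: x + y).

(** The span is encoded as an intersection of subspaces, so that induction over it is instantiation
    at a suitable subspace. *)
Definition rep_span (x : A) := forall L, subspace L -> L 1 ->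
  (forall n d e (v : 'M[A]_d) (w : 'M[A]_e) W r, fusion_chain n v w W r ->
     forall i j, L (w i j)) -> L x.

Lemma rep_span_subspace : subspace rep_span.
Proof. by move=> c x y Sx Sy L sL L1 Lw; apply: (sL); [exact: (Sx L)|exact: (Sy L)]. Qed.

Lemma subspaceD L x y : subspace L -> L x -> L y -> L (x + y).
Proof. by move=> sL Lx Ly; rewrite -[x]scale1r; apply: (sL). Qed.

Lemma subspace0 L x : subspace L -> L x -> L 0.
Proof. by move=> sL Lx; rewrite -(addNr x) -scaleN1r; apply: (sL). Qed.

Lemma subspaceZ L c x : subspace L -> L x -> L (c *: x).
Proof. by move=> sL Lx; rewrite -[_ *: _]addr0; apply: (sL) => //; exact: subspace0 sL Lx. Qed.

Lemma subspace_sum (I : finType) L x (F : I -> A) : subspace L -> L x ->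
  (forall i, L (F i)) -> L (\sum_i F i).
Proof.
move=> sL Lx LF; elim/big_ind: _ => //; first exact: subspace0 sL Lx.
by move=> ? ?; exact: subspaceD.
Qed.

Lemma rep_span1 : rep_span 1.
Proof. by move=> L. Qed.

Lemma subspace_scmx L x m n k (M : 'M[C]_(m, n)) (X : 'M[A]_n) (M' : 'M[C]_(n, k)) i j :
  subspace L -> L x -> (forall i j, L (X i j)) ->
  L ((scmx A M *m X *m scmx A M') i j).
Proof.
move=> sL Lx LX; rewrite mxmulE; apply: (subspace_sum sL Lx) => l.
rewrite scmxE mulr_algr; apply: (subspaceZ _ sL).
rewrite mxmulE; apply: (subspace_sum sL Lx) => l'.
by rewrite scmxE mulr_algl; apply: (subspaceZ _ sL).
Qed.

Lemma rep_span_high n d e (v : 'M[A]_d) (w : 'M[A]_e) W r i j :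
  fusion_chain n v w W r -> rep_span (w i j).
Proof. by move=> ch L _ _; apply; exact: ch. Qed.

Lemma rep_span_low n d e (v : 'M[A]_d) (w : 'M[A]_e) W r i j :
  fusion_chain n v w W r -> rep_span (v i j).
Proof.
move=> ch; move: i j; case: ch => [i j|*]; last by apply: rep_span_high; eassumption.
by rewrite mxE !ord1 eqxx; exact: rep_span1.
Qed.

Lemma rep_span_mul_gen x k l : rep_span x -> rep_span (x * u k l).
Proof.
have Ss := rep_span_subspace.
move=> /(_ (fun y => rep_span (y * u k l))); apply.
- by move=> c y z Sy Sz; rewrite mulrDl -scalerAl; exact: Ss.
- by rewrite mul1r; apply: rep_span_high; exact: FusionBase.
move=> n d e v w W r ch i j.
have [e' [w' [W' [r' [st' wu]]]]] := fusion_next N2 (fusion_chain_step ch).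
have /matrixP/(_ (mxtens_index (i, k)) (mxtens_index (j, l))) := wu.
rewrite tensmxE [RHS]mxE => ->; apply: (subspaceD Ss).
  apply: (subspace_scmx _ _ _ _ Ss rep_span1) => i' j'.
  by apply: rep_span_high; exact: FusionNext ch st'.
apply: (subspace_scmx _ _ _ _ Ss rep_span1) => i' j'.
exact: rep_span_low ch.
Qed.

Lemma rep_span_mul x y : rep_span x -> rep_span (x * y).
Proof.
have Ss := rep_span_subspace.
have [g1 _ _] := ogen_orthogonal C N.
rewrite -[y]olift_ogen /Defs.olift; move: (repr y) => t.
(* Carrying both a term and its star pushes [OStar] down to the generators; x is generalised for the
   product case. *)
suff H : forall x, rep_span x ->
  rep_span (x * oeval u t) /\ rep_span (x * star (oeval u t)). by move=> /H[].
elim: t {y} => [i j|c|t1 IH1 t2 IH2|t1 IH1 t2 IH2|t1 IH1] {}x Sx.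
- by rewrite /= g1; split; exact: rep_span_mul_gen.
- by rewrite /= star_alg !mulr_algr; split; apply: (subspaceZ _ Ss).
- have [? ?] := IH1 _ Sx; have [? ?] := IH2 _ Sx.
  by rewrite /= starD !mulrDr; split; apply: (subspaceD Ss).
- rewrite /= starM !mulrA; split.
    by have [/IH2[]] := IH1 _ Sx.
  by have [_ /IH1[]] := IH2 _ Sx.
- by rewrite /= starK; have [] := IH1 _ Sx.
Qed.

(* The coefficients of u^n (x) u are combinations of those of u^(n+1) and       *)
(* u^(n-1), so the coefficients of the u^n span a subalgebra containing u.      *)
Lemma OON_rep_span (L : A -> Prop) : subspace L -> L 1 ->
  (forall n d (v : 'M[A]_d), unitary_rep v -> \tr v = chi C N n.+1 ->
     forall i j, L (v i j)) -> forall x, L x.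
Proof.
move=> sL L1 Lv x; rewrite -[x]mul1r.
apply: (rep_span_mul x rep_span1) => // n d e v w W r ch i j.
by have [_ [wr wt] _ _ _] := fusion_chain_step ch; exact: Lv wt _ _.
Qed.

End Spanning.

(** * States evaluated on coefficient matrices *)

Section StateMatrices.
Variables (C : numClosedFieldType) (N : nat).
Local Notation A := (OON C N).
Implicit Types phi psi h : {linear A -> C^o}.

Definition state_mx m n (phi : A -> C^o) (v : 'M[A]_(m, n)) : 'M[C]_(m, n) :=
  \matrix_(i, j) (phi (v i j) : C).

Lemma tr_state_mx phi d (v : 'M[A]_d) : \tr (state_mx phi v) = phi (\tr v).
Proof. by rewrite /mxtrace linear_sum; apply: eq_bigr => i _; rewrite mxE. Qed.

Lemma tlift_sum (V : lmodType C) (f : A -> A -> V) (I : Type) (s : seq I) (F : I -> tensor A A) :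
  bilinear_map f -> tlift f (\sum_(i <- s) F i) = \sum_(i <- s) tlift f (F i).
Proof.
move=> bf; apply: (big_morph (tlift f)) => [x y|]; first exact: tlift_add.
exact: tlift_zero.
Qed.

Lemma convolution_mx phi psi d (v : 'M[A]_d) : corep v ->
  \matrix_(i, j) (convolution phi psi (v i j) : C) = state_mx phi v *m state_mx psi v.
Proof.
move=> cv; apply/matrixP => i j; rewrite !mxE /convolution cv tlift_sum.
  by apply: eq_bigr => k _; rewrite !mxE tlift_tens//; exact: convolution_bilinear.
exact: convolution_bilinear.
Qed.

Lemma invariant_state_mx phi h d (v : 'M[A]_d) : corep v -> phi 1 = 1 ->
  (forall x, id_tensor h (comult x) = (h x : C)%:A) ->
  state_mx phi v *m state_mx h v = state_mx h v.
Proof.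
move=> cv phi1 hinv; apply/matrixP => i j; rewrite [LHS]mxE [RHS]mxE.
have := congr1 phi (hinv (v i j)).
rewrite linearZ /= phi1 [_ *: 1]mulr1 => <-.
rewrite /id_tensor cv tlift_sum; last exact: id_tensor_bilinear.
rewrite linear_sum; apply: eq_bigr => k _.
rewrite tlift_tens; last exact: id_tensor_bilinear.
by rewrite linearZ !mxE mulrC.
Qed.

Lemma haar_state_mx_idem h d (v : 'M[A]_d) : corep v -> haar_state h ->
  state_mx h v *m state_mx h v = state_mx h v.
Proof. by move=> cv [[h1 _] hl _]; exact: invariant_state_mx. Qed.

(** The powers of M = psi_1(v) are the psi_k(v), with trace d r^k, so [fixed_mx_eq0] applies to Q =
    h(v). The value h(chi_n) is the trace of h(v) for a v given by the fusion construction. *)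
Lemma haar_chi_eq0 h (psi : nat -> {linear A -> C^o}) n d r : (2 <= N)%N ->
  haar_state h -> psi 1 1 = 1 ->
  (forall k x, psi k.+2 x = convolution (psi 1) (psi k.+1) x) ->
  (forall k, psi k.+1 (chi C N n) = d * r ^+ k.+1 :> C) -> r != 1 ->
  h (chi C N n) = 0 /\
  forall e (v : 'M[A]_e), unitary_rep v -> \tr v = chi C N n -> state_mx h v = 0.
Proof.
move=> N2 hh psi1 psiC psir r1.
suff H e (v : 'M[A]_e) : unitary_rep v -> \tr v = chi C N n -> state_mx h v = 0.
  split=> //; have [e [v [vr vt]]] := character_rep_exists C N2 n.
  by rewrite -vt -tr_state_mx (H _ _ vr vt) mxtrace0.
move=> [cv _ _] vt.
apply: (@fixed_mx_eq0 _ _ (state_mx (psi 1) v) _ d r r1).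
  move=> k; rewrite -psir -vt -tr_state_mx; congr (\tr _).
  elim: k => [|k IH]; first by rewrite /= mulmx1.
  rewrite iterS IH -convolution_mx//.
  by apply/matrixP => i j; rewrite !mxE psiC.
by apply: invariant_state_mx => //; have [_ ? _] := hh.
Qed.

End StateMatrices.

(** * The Haar state *)

(** K is a column c times a row, so each fixed vector is a multiple of c. *)
Lemma rank1_fixed_vectors (C : fieldType) m (K : 'M[C]_m) (x y : 'cV[C]_m) :
  \rank K = 1 -> K *m x = x -> K *m y = y -> y != 0 -> exists a, x = a *: y.
Proof.
move=> rK Kx Ky y0.
have [c [r KE]] : exists (c : 'cV[C]_m) (r : 'rV[C]_m), K = c *m r.
  by move: (col_base K) (row_base K) (mulmx_base K); rewrite rK => c r <-; exists c, r.
have fixE z : K *m z = z -> exists b, z = b *: c.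
  move=> Kz; exists ((r *m z) 0 0); rewrite -[LHS]Kz KE -mulmxA.
  by rewrite {1}[r *m z]mx11_scalar mul_mx_scalar.
have [a xE] := fixE _ Kx; have [b yE] := fixE _ Ky.
have b0 : b != 0 by apply: contraNneq y0 => b0; rewrite yE b0 scale0r.
by exists (a / b); rewrite yE scalerA divfK.
Qed.

Section HaarState.
Variables (C : numClosedFieldType) (N : nat).
Local Notation A := (OON C N).
Local Notation chi := (chi C N).
Variable h : {linear A -> C^o}.
Hypothesis hh : haar_state h.

(* The matrix h(v (x) v-bar) is the projection of End(C^d) onto the             *)
(* endomorphisms of v, and its trace is h(chi chi-star).                        *)
Lemma irreducible_of_norm1 d (v : 'M[A]_d) : unitary_rep v ->
  h (\tr v * star (\tr v)) = 1 -> irreducible_rep v.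
Proof.
move=> [cv v1 v2] n1.
pose K := state_mx h (v *t map_mx star v).
have [[h1 _] _ _] := hh.
have KK : K *m K = K.
  by apply: haar_state_mx_idem => //; apply: corep_tens => //; exact: corep_star.
have tK : \tr K = 1.
  rewrite tr_state_mx tr_tensmx -n1; congr (h (_ * _)).
  by rewrite star_sum; apply: eq_bigr => i _; rewrite mxE.
have rK : \rank K = 1.
  by apply/eqP; rewrite -(eqr_nat C) -trace_idem// tK.
pose vec (T : 'M[C]_d) : 'cV[C]_(d * d) :=
  \col_p T (mxtens_unindex p).1 (mxtens_unindex p).2.
have vecE T i j k : vec T (mxtens_index (i, j)) k = T i j by rewrite mxE mxtens_indexK.
(* If T commutes with v then T equals v T times the adjoint of v; applying h entrywise to the latter
   is K acting on [vec T]. *)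
have fix_comm T : scmx A T *m v = v *m scmx A T -> K *m vec T = vec T.
  move=> Tv; apply/matrixP => + q; rewrite (ord1 q); elim/mxtens_ind => i j.
  rewrite vecE mxE sum_mxtens.
  have : v *m scmx A T *m adjmx v = scmx A T.
    by rewrite -Tv -mulmxA [v *m adjmx v]v1 mulmx1.
  move=> /matrixP/(_ i j); rewrite scmxE => /(congr1 h).
  rewrite linearZ /= h1 [_ *: 1]mulr1 => <-.
  rewrite mxmulE linear_sum exchange_big /=; apply: eq_bigr => l _.
  rewrite mxmulE mulr_suml linear_sum; apply: eq_bigr => k _.
  rewrite vecE mxE tensmxE [map_mx star v _ _]mxE scmxE adjmxE mulr_algr -scalerAl.
  by rewrite linearZ mulrC.
have d0 : (0 < d)%N.
  rewrite lt0n; apply/eqP => d0; move: tK; rewrite tr_state_mx tr_tensmx.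
  rewrite /mxtrace big1 ?mul0r ?linear0 => [/esym/eqP|[k kd]]; first by rewrite oner_eq0.
  by exfalso; move: (kd); rewrite [X in (_ < X)%N]d0.
split=> // T Tv.
have fT := fix_comm _ (Tv : scmx A T *m v = v *m scmx A T).
have f1 : K *m vec 1%:M = vec 1%:M.
  by apply: fix_comm; rewrite scmx1 mul1mx mulmx1.
have vec1 : vec 1%:M != 0.
  apply/eqP => /matrixP/(_ (mxtens_index (Ordinal d0, Ordinal d0)) 0).
  by rewrite vecE !mxE eqxx => /eqP; rewrite oner_eq0.
have [a TE] := rank1_fixed_vectors rK fT f1 vec1.
apply/is_scalar_mxP; exists a; apply/matrixP => i j.
by rewrite -(vecE T i j 0) TE mxE vecE !mxE mulr_natr.
Qed.

Hypothesis h_chi : forall n, h (chi n.+1) = 0.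

Lemma haar_chi0 : h (chi 0) = 1.
Proof. by have [[h1 _] _ _] := hh. Qed.

Lemma chi_mul_chi1 m : chi m.+1 * chi 1 = chi m.+2 + chi m.
Proof. by rewrite chi_comm [chi m.+2]chebSS subrK. Qed.

Lemma chiSS n : chi n.+2 = chi 1 * chi n.+1 - chi n.
Proof. by []. Qed.

(** Moving one factor chi_1 across lowers the second index: for m >= 1, chi_m chi_(n+2) = (chi_(m+1)
    + chi_(m-1)) chi_(n+1) - chi_m chi_n. *)
Lemma haar_chi_orthonormal m n : h (chi m * chi n) = (m == n)%:R.
Proof.
elim/ltn_ind: n m => -[_ m|[_ m|n IH m]].
- by rewrite mulr1; case: m => [|m]; [exact: haar_chi0|exact: h_chi].
- case: m => [|m]; first by rewrite mul1r h_chi.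
  rewrite chi_mul_chi1 linearD /= h_chi add0r.
  by case: m => [|m]; [exact: haar_chi0|exact: h_chi].
case: m => [|m]; first by rewrite mul1r h_chi.
rewrite chiSS mulrBr mulrA chi_mul_chi1 mulrDl linearB linearD /= !IH//.
by rewrite !eqSS addrAC subrr add0r.
Qed.

Lemma star_chi n : star (chi n) = chi n.
Proof.
have s1 : star (chi 1) = chi 1.
  rewrite star_sum; apply: eq_bigr => i _.
  by have [g _ _] := ogen_orthogonal C N; exact: g.
elim/ltn_ind: n => -[|[|n]] IH; [exact: star1|exact: s1|].
by rewrite chiSS starB starM s1 !IH// chi_comm.
Qed.

Lemma character_irrep n d (v : 'M[A]_d) :
  unitary_rep v -> \tr v = chi n -> irrep n v.
Proof.
move=> vr vt; split=> //; apply: irreducible_of_norm1 => //.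
by rewrite vt star_chi haar_chi_orthonormal eqxx.
Qed.

Hypothesis N2 : (2 <= N)%N.
Hypothesis h_rep : forall n d (v : 'M[A]_d),
  unitary_rep v -> \tr v = chi n.+1 -> state_mx h v = 0.

(** By spanning it suffices to test coefficients: E sends those of u^(n+1) to multiples of
    chi_(n+1), and h kills both. *)
Lemma haar_expectation (E : {linear A -> A}) x :
  character_expectation E -> h (E x) = h x.
Proof.
move=> [_ Eid _ Erep]; apply: (OON_rep_span N2 (L := fun x => h (E x) = h x)).
- by move=> c y z Ey Ez; rewrite !linearP Ey Ez.
- by rewrite Eid//; exists 1, (fun=> 1); rewrite big_ord1 scale1r.
move=> n d v vr vt i j; rewrite (Erep _ _ _ _ _ (character_irrep vr vt)).
rewrite linearZ /= h_chi scaler0.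
by have /matrixP/(_ i j) := h_rep vr vt; rewrite !mxE => ->.
Qed.

(* On the range of E, phi - h has density z = sum (phi - h)(chi_n) chi_n with   *)
(* respect to h; truncating the sum at the degree of E x loses nothing.         *)
Lemma central_dist_l2 (phi : {linear A -> C^o}) x : central phi ->
  exists m, `|phi x - h x| ^+ 2 <=
    (\sum_(n < m) `|phi (chi n) - h (chi n)| ^+ 2) * h (star x * x).
Proof.
move=> [E EE [phi' phiE]]; have [Ech Eid Emod _] := EE.
have phiEx y : phi (E y) = phi y by rewrite !phiE Eid.
have [m [c Ex]] := Ech x; exists m.
pose a n : C := phi (chi n) - h (chi n).
(* The conjugates make [star y] the truncated density of phi - h. *)
pose y : A := \sum_(n < m) (a n)^* *: chi n.
have sy : star y = \sum_(n < m) a n *: chi n.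
  by rewrite star_sum; apply: eq_bigr => n _; rewrite starZ star_chi conjCK.
have dotE (b : nat -> C) : h (star y * \sum_(n < m) b n *: chi n) = \sum_(n < m) a n * b n.
  rewrite sy mulr_suml linear_sum; apply: eq_bigr => n _.
  rewrite mulr_sumr linear_sum (bigD1 n)//= big1 => [|k kn]; last first.
    rewrite -scalerAl -scalerAr !linearZ /= haar_chi_orthonormal.
    by rewrite val_eqE eq_sym (negPf kn) !scaler0.
  rewrite addr0 -scalerAl -scalerAr !linearZ /= haar_chi_orthonormal eqxx.
  by rewrite -[_ *: (_ *: _)]/(a n * (b n * 1)) mulr1.
(* As h = h o E and E is linear over the characters, the right-hand side is h at [star y * E x],
   which orthonormality evaluates. *)
have -> : phi x - h x = h (star y * x).
  rewrite -(haar_expectation (star y * x) EE) (Emod (star y) x _).1; last by exists m, a.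
  rewrite -phiEx -(haar_expectation x EE) Ex dotE.
  rewrite [phi _]linear_sum [h _]linear_sum -sumrB.
  apply: eq_bigr => n _.
  have lz (f : {linear A -> C^o}) b z : f (b *: z) = b * f z :> C by rewrite linearZ.
  by rewrite !lz -mulrBr mulrC.
have [[_ hpos] _ _] := hh.
apply: le_trans (state_cauchy_schwarz hpos x y) _.
rewrite (dotE (fun n => (a n)^*) : h (star y * y) = _).
by under eq_bigr do rewrite -normCK.
Qed.

End HaarState.

(** * Brownian motion *)

Section Cutoff.
Variables (R : realType) (N : nat).
Hypothesis N2 : (2 <= N)%N.
Local Notation A := (OON R[i] N).
Variables (h : {linear A -> R[i]^o}) (psi : R -> {linear A -> R[i]^o}).
Hypotheses (hh : haar_state h) (bm : brownian_motion psi).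
Local Notation chi := (chi R[i] N).

Lemma brownian_haar_chi n :
  h (chi n.+1) = 0 /\
  forall d (v : 'M[A]_d), unitary_rep v -> \tr v = chi n.+1 -> state_mx h v = 0.
Proof.
have [bm1 bm2] := bm.
(* At integer times psi_k(chi_n) = P_n(N) (e^(-lambda_n))^k, and lambda_n > 0 makes the ratio
   different from 1. *)
apply: (@haar_chi_eq0 _ _ h (fun k => psi k%:R) n.+1
  ((cheb 'X n.+1 : {poly R}).[N%:R])%:C (expR (- bm_rate R N n.+1))%:C) => //.
- by have [[-> _] _ _] := bm1 1 ler01.
- by move=> k x; rewrite -bm2 ?ler0n// addrC natr1.
- move=> k; have [_ _ ->] := bm1 k.+1%:R (ler0n _ _).
  by rewrite realcM; congr (_ * _); rewrite -realcX -expRM_natl mulrN.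
rewrite -(rmorph1 (real_complex R)) (inj_eq (@complexI R)).
rewrite -expR0 (inj_eq (@expR_inj R)) oppr_eq0 gt_eqF//.
apply: lt_le_trans (bm_rate_ge R N2 n.+1); rewrite divr_gt0// ltr0n//.
exact: leq_trans N2.
Qed.

Let h_chi n : h (chi n.+1) = 0. Proof. exact: (brownian_haar_chi n).1. Qed.

(** The term n = 0 vanishes since both states are 1 at the unit; the others are dominated by a
    geometric series of ratio q = rho^2. *)
Lemma brownian_l2_bound (t : R) x : 0 <= t ->
  let q := (N%:R * expR (- (t / N%:R))) ^+ 2 in q < 1 ->
  `|psi t x - h x| ^+ 2 <= (q / (1 - q))%:C * h (star x * x).
Proof.
move=> t0 q q1; have [_ cent psi_chi] := bm.1 t t0.
have [m Hm] := central_dist_l2 hh h_chi N2 (fun n => (brownian_haar_chi n).2) x cent.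
apply: le_trans Hm _; have [[_ hpos] _ _] := hh.
apply: ler_wpM2r => //.
have q0 : 0 <= q by rewrite exprn_ge0// mulr_ge0// expR_ge0.
have term n : `|psi t (chi n.+1) - h (chi n.+1)| ^+ 2 <= (q ^+ n.+1)%:C.
  rewrite h_chi subr0 psi_chi; have /andP[b0 b1] := bm_value_bound N2 n.+1 t0.
  rewrite ger0_norm ?ler0c// -realcX lecR /q -exprM mulnC exprM.
  by rewrite lerXn2r ?nnegrE ?exprn_ge0// mulr_ge0// expR_ge0.
have geom k : \sum_(n < k) q ^+ n.+1 <= q / (1 - q).
  rewrite ler_pdivlMr ?subr_gt0//.
  have -> : (\sum_(n < k) q ^+ n.+1) * (1 - q) = q - q ^+ k.+1.
    elim: k => [|k IH]; first by rewrite big_ord0 mul0r expr1 subrr.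
    by rewrite big_ord_recr /= mulrDl IH !exprS; ring.
  by rewrite lerBlDr lerDl exprn_ge0.
case: m => [|m]; first by rewrite big_ord0 ler0c divr_ge0// subr_ge0 ltW.
rewrite big_ord_recl.
have -> : psi t (chi 0) = 1 by have [[-> _] _ _] := bm.1 t t0.
rewrite haar_chi0// subrr normr0 expr0n add0r.
apply: (@le_trans _ _ (\sum_(n < m) q ^+ n.+1)%:C); last by rewrite lecR.
by rewrite (rmorph_sum (real_complex R)); apply: ler_sum => n _; exact: term.
Qed.

Lemma bm_rate1 : bm_rate R N 1 = N%:R^-1.
Proof. by rewrite /bm_rate [cheb _ 1]/('X) derivX hornerC hornerX mul1r. Qed.

Variables (B : cstarAlgebra R) (iota : A -> B).
Variables (hB : {linear B -> R[i]^o}) (psiB : {linear B -> R[i]^o}) (t : R).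
Hypotheses (t0 : 0 <= t) (env : enveloping_cstar iota).
Hypotheses (extH : cstar_extension iota h hB) (extP : cstar_extension iota (psi t) psiB).

Let iota_hom : star_hom_to_cstar iota. Proof. by have [] := env. Qed.
Let iota_dense : dense (range iota). Proof. by have [] := env. Qed.
Let h_state : state h. Proof. by have [] := hh. Qed.
Let psi_state : state (psi t). Proof. by have [] := bm.1 t t0. Qed.
Local Notation rho := (N%:R * expR (- (t / N%:R))).

Lemma half_fs_dist_brownian_le1 : half_fs_dist psiB hB <= 1.
Proof. exact: (half_fs_dist_le1 iota_hom iota_dense psi_state h_state extP extH). Qed.

Lemma half_fs_dist_brownian_ge0 : 0 <= half_fs_dist psiB hB.
Proof.
have := half_fs_dist_ge iota_hom iota_dense psi_state h_state extP extH (x := 0) ltr01.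
rewrite (cstar_hom0 iota_hom) normr0 ler0c ler01 => /(_ isT).
by rewrite !linear0 addr0 normr0 /= mulr1 pmulr_rge0.
Qed.

(** For rho <= 1/2 one has q/(1 - q) <= 4 q = (2 rho)^2, so the states differ by at most 2 rho on
    the unit ball, which the factor 1/2 turns into rho. *)
Lemma half_fs_dist_brownian_le : 2 * rho <= 1 -> half_fs_dist psiB hB <= rho.
Proof.
move=> r1; have r0 : 0 <= rho by rewrite mulr_ge0// expR_ge0.
have rho4 : rho ^+ 2 <= 4^-1.
  have : (2 * rho) ^+ 2 <= 1 by rewrite exprn_ile1// mulr_ge0.
  by rewrite exprMn; move: (rho ^+ 2) => a; lra.
have q0 : 0 <= rho ^+ 2 by rewrite exprn_ge0.
have q1 : rho ^+ 2 < 1 by move: (rho ^+ 2) rho4 => a; lra.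
have -> : rho = 2 * rho / 2 by rewrite [RHS]mulrC mulKf// pnatr_eq0.
apply: (half_fs_dist_le iota_dense extP extH); first by rewrite mulr_ge0.
move=> x; rewrite -(@ler_sqr _ `|_|) ?nnegrE ?normr_ge0 ?mulr_ge0 ?ler0c ?mulr_ge0//.
apply: le_trans (brownian_l2_bound x t0 q1) _.
rewrite [leRHS]exprMn -realcX; apply: ler_pM.
- by rewrite ler0c divr_ge0// subr_ge0 ltW.
- exact: h_state.2.
- rewrite lecR ler_pdivrMr ?subr_gt0// (exprMn _ 2).
  move: (rho ^+ 2) q0 rho4 => a a0 a4.
  have : 0 <= a * (4^-1 - a) by rewrite mulr_ge0// subr_ge0.
  lra.
rewrite (le_trans (real_ler_norm _)) ?ger0_real ?h_state.2//.
by rewrite -(cstar_norm_star iota_hom) (state_contractive iota_hom _ h_state extH).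
Qed.

(** For X = chi_1 one has X^2 = chi_2 + 1, so the variance of X under psi_t is psi_t(chi_2) + 1 -
    rho^2, at most 1 because psi_t(chi_2) <= rho^2. *)
Lemma half_fs_dist_brownian_ge : 1 <= rho -> 1 - 10 / rho <= half_fs_dist psiB hB.
Proof.
move=> r1; have [_ _ psi_chi] := bm.1 t t0; have [psi1 _] := psi_state.
have psiX : psi t (chi 1) = rho%:C.
  by rewrite psi_chi [cheb _ 1]/('X) hornerX bm_rate1.
have XX : chi 1 * chi 1 = chi 2 + 1 by rewrite (chi_mul_chi1 _ _ 0).
apply: (state_separation iota_hom iota_dense psi_state h_state extP extH
  (X := chi 1) _ r1); first exact: star_chi.
  by rewrite haar_chi_orthonormal.
have /andP[_] := bm_value_bound N2 2 t0.
move: (psi_chi 2); move: (_ * _) => b; move: rho psiX => r psiX psi2 b1.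
have -> : (chi 1 - r%:C%:A) * (chi 1 - r%:C%:A) =
    chi 2 + 1 - r%:C *: chi 1 - r%:C *: chi 1 + (r ^+ 2)%:C%:A.
  rewrite mulrBl !mulrBr XX !(mulr_algl, mulr_algr) scalerA -realcM -expr2.
  by rewrite opprB addrA addrAC.
move: psi2; move: (chi 2) => c2 psi2; move: psiX; move: (chi 1) => c1 psiX.
have -> : psi t (c2 + 1 - r%:C *: c1 - r%:C *: c1 + (r ^+ 2)%:C%:A)
    = (b + 1 - r ^+ 2)%:C.
  have -> : (b + 1 - r ^+ 2)%:C = b%:C + 1 - r%:C ^+ 2 :> R[i].
    by rewrite -realcX rmorphB rmorphD rmorph1.
  rewrite !(linearD, linearB, linearZ) /= psi1 psiX psi2 realcX.
  have id5 (p s : R[i]) : p + 1 + -1 * (s * s) + -1 * (s * s) + s ^+ 2 * 1 =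
    p + 1 - s ^+ 2 by ring.
  exact: id5.
by rewrite -[leRHS]/(1%:C) lecR; lra.
Qed.

End Cutoff.

(** * Limits around the cutoff time *)

Lemma expRN_ln_cvg0 (R : realType) (eps : R) : 0 < eps ->
  expR (- (eps * ln N%:R)) @[N --> \oo] --> (0 : R).
Proof.
move=> e0; apply/cvgr0Pnorm_lt => d d0.
near=> N.
have NK : expR (- ln d / eps) < N%:R by near: N; exact: nbhs_infty_gtr.
rewrite ger0_norm ?expR_ge0// -[ltRHS]lnK// ltr_expR ltrNl mulrC -ltr_pdivrMr//.
rewrite -[ltLHS]expRK ltr_ln ?posrE ?expR_gt0//.
exact: lt_trans (expR_gt0 _) NK.
Unshelve. all: by end_near. Qed.

(** Used with c = eps after the cutoff and c = -eps before it, where rho is N^(-eps) and N^eps. *)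
Lemma cutoff_scale (R : realType) (N : nat) (c : R) : (0 < N)%N ->
  N%:R * expR (- ((1 + c) * cutoff_time R N / N%:R)) = expR (- (c * ln N%:R)).
Proof.
move=> N0; have NR : 0 < N%:R :> R by rewrite ltr0n.
rewrite /cutoff_time mulrCA mulrAC mulfV ?gt_eqF// mul1r.
by rewrite -{1}[N%:R]lnK// -expRD; congr expR; ring.
Qed.

Unset Implicit Arguments.

(** The data are constrained from N = 2 on, where every P_n(N) is positive, whereas P_2(1) = 0; the
    limits see only large N. *)
Theorem theorem3p1 (R : realType)
    (B : nat -> cstarAlgebra R)
    (iota : forall N : nat, OON R[i] N -> B N)
    (h : forall N : nat, {linear OON R[i] N -> R[i]^o})
    (psi : forall N : nat, R -> {linear OON R[i] N -> R[i]^o})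
    (hB : forall N : nat, {linear B N -> R[i]^o})
    (psiB : forall N : nat, R -> {linear B N -> R[i]^o})
    (iota_enveloping : forall N : nat, (2 <= N)%N ->
       enveloping_cstar (iota N))
    (h_haar : forall N : nat, (2 <= N)%N -> haar_state (h N))
    (psi_brownian : forall N : nat, (2 <= N)%N -> brownian_motion (psi N))
    (hB_ext : forall N : nat, (2 <= N)%N ->
       cstar_extension (iota N) (h N) (hB N))
    (psiB_ext : forall (N : nat) (t : R), (2 <= N)%N -> 0 <= t ->
       cstar_extension (iota N) (psi N t) (psiB N t))
    (eps : R) (eps_gt0 : 0 < eps) :
  (eps < 1 ->
    half_fs_dist (psiB N ((1 - eps) * cutoff_time R N)) (hB N)
      @[N --> \oo] --> (1 : R)) /\
  half_fs_dist (psiB N ((1 + eps) * cutoff_time R N)) (hB N)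
    @[N --> \oo] --> (0 : R).
Proof.
have r_cvg := expRN_ln_cvg0 eps_gt0.
have near2 : \forall N \near \oo, (2 <= N)%N by exact: nbhs_infty_ge.
have t_ge0 c N : 0 <= c -> (2 <= N)%N -> 0 <= c * cutoff_time R N.
  move=> c0 N2; apply: mulr_ge0 => //; apply: mulr_ge0 => //; apply: ln_ge0.
  by rewrite ler1n ltnW.
split=> [eps_lt1|].
  apply: (@squeeze_cvgr _ _ _ _ (fun N => 1 - 10 * expR (- (eps * ln N%:R))) (fun=> 1)).
  - near=> N; have N2 : (2 <= N)%N by near: N.
    have t0 : 0 <= (1 - eps) * cutoff_time R N by apply: t_ge0 => //; lra.
    have := cutoff_scale (- eps) (ltnW N2); rewrite mulNr opprK => rhoE.
    rewrite (half_fs_dist_brownian_le1 (h_haar N N2) (psi_brownian N N2) t0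
      (iota_enveloping N N2) (hB_ext N N2) (psiB_ext N _ N2 t0)) andbT.
    rewrite expRN -rhoE.
    apply: (half_fs_dist_brownian_ge N2 (h_haar N N2) (psi_brownian N N2) t0
      (iota_enveloping N N2) (hB_ext N N2) (psiB_ext N _ N2 t0)).
    rewrite rhoE -[leLHS]expR0 ler_expR; apply: mulr_ge0; first exact: ltW.
    by apply: ln_ge0; rewrite ler1n ltnW.
  - rewrite -[X in _ --> X](subr0 1) -[X in _ --> _ - X](mulr0 10).
    by apply: cvgB; [exact: cvg_cst|apply: cvgM; [exact: cvg_cst|]].
  - exact: cvg_cst.
apply: (@squeeze_cvgr _ _ _ _ (fun=> 0) (fun N => expR (- (eps * ln N%:R)))) => //;
  last exact: cvg_cst.
near=> N; have N2 : (2 <= N)%N by near: N.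
have t0 : 0 <= (1 + eps) * cutoff_time R N by apply: t_ge0 => //; lra.
rewrite (half_fs_dist_brownian_ge0 (h_haar N N2) (psi_brownian N N2) t0
  (iota_enveloping N N2) (hB_ext N N2) (psiB_ext N _ N2 t0)) /=.
have rhoE := cutoff_scale eps (ltnW N2); rewrite -rhoE.
apply: (half_fs_dist_brownian_le N2 (h_haar N N2) (psi_brownian N N2) t0
  (iota_enveloping N N2) (hB_ext N N2) (psiB_ext N _ N2 t0)).
(* The condition 2 rho <= 1 holds eventually because rho = N^(-eps) tends to 0. *)
rewrite rhoE -ler_pdivlMl// mulr1; near: N.
by apply: (cvgr_le _ r_cvg); rewrite invr_gt0.
Unshelve. all: by end_near. Qed.
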